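(* Let $c_0=1/(6\mathrm{e})$, where $\mathrm{e}$ is the base of the natural logarithm, let $\epsilon,\delta>0$ be such that $\epsilon/\delta\le c_0$, and let $D_0\subset\mathbb{C}^d$. Let $M_{\epsilon/\delta}=\left\lfloor c_0\delta/\epsilon\right\rfloor+1$. Then for any analytic map $F:D_\delta\to\mathbb{C}^d$ with $\|F-\mathrm{id}\|_{D_\delta}\le\epsilon$ the following holds. (1) The interpolating vector field of order one satisfies $\|X_1\|_{D_\delta}\le\epsilon$ and $$\bigl\|\Phi^1_{X_1}-F\bigr\|_{D_0}\le 2\epsilon^2/\delta.$$ (2) For every integer $m\in[2,M_{\epsilon/\delta}]$ the interpolating vector field of order $m$ satisfies $\|X_m\|_{D_{\delta/3}}\le2\epsilon$ and $$\bigl\|\Phi^1_{X_m}-F\bigr\|_{D_0}\le 3\epsilon\left(\frac{6(m-1)\epsilon}{\delta}\right)^{m}.$$ (3) In particular, for $m=M_{\epsilon/\delta}$, $$\bigl\|\Phi^1_{X_m}-F\bigr\|_{D_0}\le 3\,\epsilon\exp\left(-c_0\,\delta/\epsilon\right).$$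
   Context: For vectors in $\mathbb{C}^d$, $|\cdot|$ is the maximum component norm. For $D_0\subset\mathbb{C}^d$ and $\rho>0$, $D_\rho$ denotes the $\rho$-neighbourhood of $D_0$ (points at distance less than $\rho$ from $D_0$). For a map $G$ on a set $D$, $\|G\|_{D}=\sup_{x\in D}|G(x)|$. $\Phi^t_X$ denotes the time-$t$ map of the flow of $\dot x=X(x)$. The interpolating vector field of order $m\ge1$ of $F$ (Newton forward interpolation scheme) is $$X_m(x)=\sum_{k=1}^m\frac{(-1)^{k-1}}{k}\Delta_k(x),$$ where $\Delta_0(x)=x$ and $\Delta_k(x)=\Delta_{k-1}(F(x))-\Delta_{k-1}(x)$ for $k\ge1$; it is defined at points $x$ whose forward iterates under $F$ appearing in the formula are defined. In particular $X_1(x)=F(x)-x$. *)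

(* Defs.v *)
(* MathComp / MathComp-Analysis. *)
From HB Require Import structures.
From mathcomp Require Import all_boot all_order all_algebra finmap complex.
From mathcomp Require Import all_classical all_reals all_analysis.
From mathcomp Require summability.

Set Implicit Arguments.
Unset Strict Implicit.
Unset Printing Implicit Defensive.

Import Order.TTheory GRing.Theory Num.Theory numFieldNormedType.Exports.

Local Open Scope classical_set_scope.
Local Open Scope ring_scope.
Local Open Scope complex_scope.

(* The norm that the library puts on row vectors is the maximum norm. *)
Definition Cd (R : realType) (d : nat) : normedModType R[i] := 'rV[R[i]]_d.

Section Definitions.
Variables (R : realType) (d : nat).
Implicit Types (D U : set (Cd R d)) (F X : Cd R d -> Cd R d) (x y h : Cd R d).

(* `|x| is an element of R[i] with zero imaginary part. *)
Definition vnorm x : R := complex.Re `|x|.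

Definition neighbourhood D (rho : R) : set (Cd R d) :=
  [set x | exists2 y, D y & vnorm (x - y) < rho].

(* The supremum over the empty set is -oo. *)
Definition supnorm D (G : Cd R d -> Cd R d) : \bar R :=
  ereal_sup [set (vnorm (G x))%:E | x in D].

Definition monomial h (a : {ffun 'I_d -> nat}) : R[i] :=
  \prod_(j < d) (h 0 j : R[i]) ^+ a j.

(* [summability.totally] is the filter of large finite sets of multi-indices:
   the power series converges unconditionally (equivalently, since the
   dimension is finite, absolutely) to F (x + h). *)
Definition analytic_at F x : Prop :=
  exists (r : R) (c : {ffun 'I_d -> nat} -> Cd R d), 0 < r /\
    forall h, vnorm h < r ->
      summability.partial_sum (fun a => monomial h a *: c a : Cd R d)
        @ summability.totally --> (F (x + h) : Cd R d).

Definition analytic_on U F : Prop := forall x, U x -> analytic_at F x.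

Fixpoint newton_diff F (k : nat) x : Cd R d :=
  if k is k'.+1 then newton_diff F k' (F x) - newton_diff F k' x else x.

Definition interp_field F (m : nat) x : Cd R d :=
  \sum_(1 <= k < m.+1)
    ((-1) ^+ k.-1 / k%:R : R[i]) *: (newton_diff F k x : Cd R d).

(* A map D -> C^d is represented by a total function F whose values outside D
   are irrelevant.  The order m field involves F^j (x) for j <= m, and these
   are defined when F^j (x) lies in D for every j < m. *)
Definition interp_dom D F (m : nat) : set (Cd R d) :=
  [set x | forall j, (j < m)%N -> D (iter j F x)].

(* Solution on [0, t], t >= 0, of g' = X(g) staying in the domain U of X;
   the derivative is one-sided at the end points. *)
Definition integral_curve U X (t : R) (g : R -> Cd R d) : Prop :=
  forall s, 0 <= s <= t ->
    U (g s) /\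
    ((u - s)^-1)%:C *: (g u - g s) @[u --> within `[0, t] s^']
      --> (X (g s) : Cd R d).

Definition flows_to U X (t : R) x y : Prop :=
  exists g, [/\ g 0 = x, g t = y & integral_curve U X t g].

Definition flow_dom U X (t : R) : set (Cd R d) :=
  [set x | exists! y, flows_to U X t x y].

(* The time-t map of the flow; only meaningful on [flow_dom U X t]. *)
Definition flow U X (t : R) x : Cd R d := xget x (flows_to U X t x).

End Definitions.

(* Main.v *)
Require Import Defs.
From HB Require Import structures.
From mathcomp Require Import all_boot all_order all_algebra finmap complex.
From mathcomp Require Import all_classical all_reals all_analysis.
From mathcomp Require Import ring lra.
From mathcomp Require summability.

Set Implicit Arguments.
Unset Strict Implicit.
Unset Printing Implicit Defensive.

Import Order.TTheory GRing.Theory Num.Theory numFieldNormedType.Exports.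

Local Open Scope classical_set_scope.
Local Open Scope ring_scope.

(* Put Delta_k for the k-th Newton difference of F, b_k(s) for the binomial
   (s choose k), gamma(s) = sum_(k <= m) b_k(s) Delta_k(y) for the Newton
   interpolation of the orbit of y in D_0, and E = gamma' - X_m(gamma) for the
   defect of gamma as a solution of x' = X_m(x).  As gamma(0) = y and
   gamma(1) = F(y), Gronwall reduces the theorem to a bound on E over [0, 1].

   For |F - id| <= e, the Schwarz lemma on complex lines shows that each
   difference gains a factor O(e), so Delta_k = O(e^k).  Up to terms of size
   O(e^(m+1)), E(s) coincides with a function that is holomorphic and O(e) on
   a disc |s| <= T with T of order 1/e and that vanishes at s = 0, ..., m - 1;
   dividing by s (s - 1) ... (s - m + 1) gives E = O(e^(m+1)) on [0, 1].  Apply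
   this to F_mu = id + mu (F - id): E is holomorphic in mu, of order m + 1 at
   mu = 0, and bounded by (5/2) eps |mu| for |mu| <= mu_0 =
   delta / (6 (m-1) eps), so the Schwarz lemma in mu bounds it at mu = 1 by
   (5/2) eps mu_0^(-m).

   The only complex analysis needed is the maximum principle, and it is proved
   for functions that have a second order Taylor expansion with cubic error at
   every point.  This class is stable under composition with analytic maps, so
   no integration is involved. *)

(** * Modulus and second order jets *)

(** Two estimates of the defect are combined because neither suffices alone. The one for small e
    yields the order of vanishing at mu = 0, with constants far too large to be kept; the Schwarz
    lemma in mu uses that order only. The one on |mu| <= mu_0 sees no cancellation between gamma'
    and X_m(gamma), but its constants are explicit, and they are the ones that survive. The chain of
    constants is as follows. If 6 (m-1) e <= delta, successive differences shrink by a factor 1/3 on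
    the ball of radius delta/3, and the sum of 3^(1-k)/k is at most 5/4. Both gamma' and X_m are
    therefore at most (5/4) e, which gives 5/2 for the defect. On the ball of radius (5/4) eps
    around y the field has Lipschitz constant 1/3, so Gronwall contributes 1/(1 - 1/6) = 6/5, and
    (5/2)(6/5) = 3. Finally 6 c_0 = exp(-1), so for m <= M the base 6 (m-1) eps / delta is at most
    exp(-1), and M >= c_0 delta / eps turns its M-th power into the exponential bound. *)

Section ComplexModulus.
Local Open Scope complex_scope.
Variable R : realType.
Implicit Types (z w : R[i]) (x : R).

Definition cabs z : R := complex.Re `|z|.

Lemma normc_cabs z : `|z| = (cabs z)%:C.
Proof. by rewrite /cabs normc_def. Qed.

Lemma cabs_ge0 z : 0 <= cabs z.
Proof. by rewrite -ler0c -normc_cabs. Qed.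

Lemma cabs0 : cabs 0 = 0.
Proof. by rewrite /cabs normr0. Qed.

Lemma cabs1 : cabs 1 = 1.
Proof. by rewrite /cabs normr1. Qed.

Lemma cabs_eq0 z : (cabs z == 0) = (z == 0).
Proof. by rewrite -[RHS]normr_eq0 normc_cabs -(inj_eq (@complexI R)). Qed.

Lemma cabs_gt0 z : (0 < cabs z) = (z != 0).
Proof. by rewrite lt_def cabs_ge0 andbT cabs_eq0. Qed.

Lemma cabsD z w : cabs (z + w) <= cabs z + cabs w.
Proof. by rewrite -lecR rmorphD /= -!normc_cabs ler_normD. Qed.

Lemma cabsM z w : cabs (z * w) = cabs z * cabs w.
Proof. by apply: complexI; rewrite rmorphM /= -!normc_cabs normrM. Qed.

Lemma cabsN z : cabs (- z) = cabs z.
Proof. by rewrite /cabs normrN. Qed.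

Lemma cabsB z w : cabs (z - w) <= cabs z + cabs w.
Proof. by rewrite -(cabsN w) cabsD. Qed.

Lemma cabsC z w : cabs (z - w) = cabs (w - z).
Proof. by rewrite -cabsN opprB. Qed.

Lemma cabsV z : cabs z^-1 = (cabs z)^-1.
Proof. by apply: complexI; rewrite fmorphV /= -!normc_cabs normfV. Qed.

Lemma cabsX z n : cabs (z ^+ n) = cabs z ^+ n.
Proof. by apply: complexI; rewrite rmorphXn /= -!normc_cabs normrX. Qed.

Lemma cabs_real x : cabs x%:C = `|x|.
Proof. by rewrite /cabs normc_def /= expr0n /= addr0 sqrtr_sqr. Qed.

Lemma cabs_nat n : cabs n%:R = n%:R.
Proof. by rewrite /cabs normr_nat -(rmorph_nat (@real_complex_def R (Phant R))). Qed.

Lemma cabs_i : cabs 'i = 1.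
Proof. by rewrite /cabs normc_def /= expr0n expr1n /= add0r sqrtr1. Qed.

Lemma cabs_sqr z : cabs z ^+ 2 = complex.Re z ^+ 2 + complex.Im z ^+ 2.
Proof. by apply: complexI; rewrite add_Re2_Im2 normc_cabs rmorphXn. Qed.

Lemma cabs_Re z : `|complex.Re z| <= cabs z.
Proof.
by rewrite -(@ler_pXn2r _ 2) ?nnegrE ?cabs_ge0 // cabs_sqr real_normK ?num_real // lerDl sqr_ge0.
Qed.

Lemma cabs_Im z : `|complex.Im z| <= cabs z.
Proof.
by rewrite -(@ler_pXn2r _ 2) ?nnegrE ?cabs_ge0 // cabs_sqr real_normK ?num_real // lerDr sqr_ge0.
Qed.

Lemma cabs_le_ReIm z : cabs z <= `|complex.Re z| + `|complex.Im z|.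
Proof.
rewrite -(@ler_pXn2r _ 2) ?nnegrE ?cabs_ge0 ?addr_ge0 // cabs_sqr sqrrD.
rewrite !real_normK ?num_real // -addrA lerD2l lerDr.
by rewrite mulrn_wge0 // mulr_ge0.
Qed.

Lemma cabs_sum (I : Type) (s : seq I) (P : pred I) (f : I -> R[i]) :
  cabs (\sum_(i <- s | P i) f i) <= \sum_(i <- s | P i) cabs (f i).
Proof.
elim/big_rec2: _ => [|i y z _ le_yz]; first by rewrite cabs0.
by rewrite (le_trans (cabsD _ _)) // lerD2l.
Qed.

End ComplexModulus.

Section Jets.
Local Open Scope complex_scope.
Variable R : realType.
Implicit Types (f g : R[i] -> R[i]) (a : R[i]).

(** Explicit constants instead of a filter: [K] and [eta] are reused quantitatively in the maximum
    principle. For [k = 0] this is local boundedness. *)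
Definition order_ge g (k : nat) a : Prop :=
  exists K eta : R, [/\ 0 <= K, 0 < eta &
    forall z, cabs (z - a) < eta -> cabs (g z) <= K * cabs (z - a) ^+ k].

Lemma eq_order_ge f g k a : f =1 g -> order_ge f k a -> order_ge g k a.
Proof. by move=> /funext ->. Qed.

Lemma order_geD f g k a : order_ge f k a -> order_ge g k a ->
  order_ge (fun z => f z + g z) k a.
Proof.
move=> [K [e [K0 e0 fK]]] [L [d [L0 d0 gL]]].
exists (K + L), (Num.min e d); split; rewrite ?addr_ge0 ?lt_min ?e0 //.
move=> z; rewrite lt_min => /andP[ze zd].
by rewrite (le_trans (cabsD _ _)) // mulrDl lerD // ?fK ?gL.
Qed.

Lemma order_geM f g k l a :
  order_ge f k a -> order_ge g l a -> order_ge (fun z => f z * g z) (k + l) a.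
Proof.
move=> [K [e [K0 e0 fK]]] [L [d [L0 d0 gL]]].
exists (K * L), (Num.min e d); split; rewrite ?mulr_ge0 ?lt_min ?e0 //.
move=> z; rewrite lt_min => /andP[ze zd].
by rewrite cabsM exprD mulrACA ler_pM ?cabs_ge0 // ?fK ?gL.
Qed.

Lemma order_ge_le f k l a : (k <= l)%N -> order_ge f l a -> order_ge f k a.
Proof.
move=> kl [K [e [K0 e0 fK]]]; exists K, (Num.min e 1); split => //.
  by rewrite lt_min e0 /=.
move=> z; rewrite lt_min => /andP[ze z1]; rewrite (le_trans (fK _ ze)) //.
by rewrite ler_wpM2l // ler_wiXn2l ?cabs_ge0 // ltW.
Qed.

Lemma order_ge_cst c a : order_ge (fun=> c) 0 a.
Proof. by exists (cabs c), 1; split; rewrite ?cabs_ge0 // => z _;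
  rewrite expr0 mulr1. Qed.

Lemma order_ge_subX a k : order_ge (fun z => (z - a) ^+ k) k a.
Proof. by exists 1, 1; split => // z _; rewrite cabsX mul1r. Qed.

(** The remainder must be cubic: in [jet2_no_max] it competes with a gain of exact size k s^2, which
    a quadratic remainder could cancel. *)
Definition jet2 g a : Prop := exists b c : R[i],
  order_ge (fun z => g z - (g a + b * (z - a) + c * (z - a) ^+ 2)) 3 a.

Lemma eq_jet2 f g a : f =1 g -> jet2 f a -> jet2 g a.
Proof. by move=> /funext ->. Qed.

Lemma jet2_order_ge1 g a : jet2 g a -> order_ge (fun z => g z - g a) 1 a.
Proof.
move=> [b [c gO]].
apply: (@eq_order_ge (fun z => (g z - (g a + b * (z - a) + c * (z - a) ^+ 2)) +
  (b * (z - a) ^+ 1 + c * (z - a) ^+ 2))); first by move=> z; ring.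
apply: order_geD; first exact: order_ge_le gO.
apply: order_geD; first exact: (order_geM (order_ge_cst _ _) (order_ge_subX _ _)).
by apply: (@order_ge_le _ _ 2) => //;
  exact: (order_geM (order_ge_cst _ _) (order_ge_subX _ _)).
Qed.

Lemma jet2_order_ge0 g a : jet2 g a -> order_ge g 0 a.
Proof.
move=> /jet2_order_ge1 gO.
apply: (@eq_order_ge (fun z => (g z - g a) + g a)); first by move=> z; ring.
by apply: order_geD; [exact: order_ge_le gO | exact: order_ge_cst].
Qed.

Lemma jet2_perturb f g a : f a = g a -> order_ge (fun z => f z - g z) 3 a ->
  jet2 g a -> jet2 f a.
Proof.
move=> fga fgO [b [c gO]]; exists b, c; rewrite fga.
by apply: eq_order_ge (order_geD fgO gO) => z; ring.
Qed.

Lemma jet2_cst c a : jet2 (fun=> c) a.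
Proof.
exists 0, 0; exists 0, 1; split => // z _.
by rewrite !mul0r !addr0 subrr cabs0.
Qed.

Lemma jet2_id a : jet2 (fun z => z) a.
Proof.
exists 1, 0; exists 0, 1; split => // z _.
have -> : z - (a + 1 * (z - a) + 0 * (z - a) ^+ 2) = 0 by ring.
by rewrite cabs0 mul0r.
Qed.

Lemma jet2D f g a : jet2 f a -> jet2 g a -> jet2 (fun z => f z + g z) a.
Proof.
move=> [b [c fO]] [b' [c' gO]]; exists (b + b'), (c + c').
by apply: eq_order_ge (order_geD fO gO) => z; ring.
Qed.

Lemma jet2M f g a : jet2 f a -> jet2 g a -> jet2 (fun z => f z * g z) a.
Proof.
move=> fJ gJ; have [b [c fO]] := fJ; have [b' [c' gO]] := gJ.
exists (f a * b' + b * g a), (f a * c' + b * b' + c * g a).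
pose F z := f a + b * (z - a) + c * (z - a) ^+ 2.
(* With G the quadratic part of g, the remainder is (f - F) g + F (g - G) plus the terms of degree 3
   and 4 of F G. *)
apply: (@eq_order_ge (fun z => (f z - F z) * g z +
   (F z * (g z - (g a + b' * (z - a) + c' * (z - a) ^+ 2)) +
   ((b * c' + c * b') + c * c' * (z - a) ^+ 1) * (z - a) ^+ 3))).
  by rewrite /F => z; ring.
apply: order_geD; first exact: (order_geM fO (jet2_order_ge0 gJ)).
apply: order_geD.
  apply: (@order_geM _ _ 0 3) gO; rewrite /F.
  apply: order_geD; first apply: order_geD (order_ge_cst _ _) _.
    apply: (@order_ge_le _ _ 1) => //;
      exact: (order_geM (order_ge_cst _ _) (order_ge_subX a 1)).
  by apply: (@order_ge_le _ _ 2) => //;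
    exact: (order_geM (order_ge_cst _ _) (order_ge_subX _ _)).
apply: (@order_geM _ _ 0 3) (order_ge_subX _ _).
apply: order_geD (order_ge_cst _ _) _.
by apply: (@order_ge_le _ _ 1) => //;
  exact: (order_geM (order_ge_cst _ _) (order_ge_subX a 1)).
Qed.

Lemma jet2N f a : jet2 f a -> jet2 (fun z => - f z) a.
Proof.
by move=> fJ; apply: eq_jet2 (jet2M (jet2_cst (-1) a) fJ) => z; rewrite mulN1r.
Qed.

Lemma jet2B f g a : jet2 f a -> jet2 g a -> jet2 (fun z => f z - g z) a.
Proof. by move=> fJ gJ; apply: jet2D => //; exact: jet2N. Qed.

Lemma jet2X f n a : jet2 f a -> jet2 (fun z => f z ^+ n) a.
Proof.
move=> fJ; elim: n => [|n IHn]; first exact: jet2_cst.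
by apply: eq_jet2 (jet2M fJ IHn) => z; rewrite exprS.
Qed.

Lemma jet2_sum (I : Type) (s : seq I) (P : pred I) (f : I -> R[i] -> R[i]) a :
  (forall i, P i -> jet2 (f i) a) ->
    jet2 (fun z => \sum_(i <- s | P i) f i z) a.
Proof.
move=> fJ; elim: s => [|i s IHs].
  by apply: eq_jet2 (jet2_cst 0 a) => z; rewrite big_nil.
case Pi: (P i); last by apply: eq_jet2 IHs => z; rewrite big_cons Pi.
by apply: eq_jet2 (jet2D (fJ i Pi) IHs) => z; rewrite big_cons Pi.
Qed.

Lemma jet2_prod (I : Type) (s : seq I) (P : pred I) (f : I -> R[i] -> R[i]) a :
  (forall i, P i -> jet2 (f i) a) ->
    jet2 (fun z => \prod_(i <- s | P i) f i z) a.
Proof.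
move=> fJ; elim: s => [|i s IHs].
  by apply: eq_jet2 (jet2_cst 1 a) => z; rewrite big_nil.
case Pi: (P i); last by apply: eq_jet2 IHs => z; rewrite big_cons Pi.
by apply: eq_jet2 (jet2M (fJ i Pi) IHs) => z; rewrite big_cons Pi.
Qed.

Lemma order_ge1_small g a e : order_ge g 1 a -> 0 < e ->
  exists2 eta : R, 0 < eta & forall z, cabs (z - a) < eta -> cabs (g z) < e.
Proof.
move=> [K [d [K0 d0 gK]]] e0; exists (Num.min d (e / (K + 1))).
  by rewrite lt_min d0 divr_gt0 // ltr_wpDl.
move=> z; rewrite lt_min => /andP[zd ze]; apply: le_lt_trans (gK _ zd) _.
rewrite expr1; move: ze; rewrite ltr_pdivlMr ?ltr_wpDl // mulrC;
  apply: le_lt_trans.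
by rewrite ler_wpM2r ?cabs_ge0 // lerDl.
Qed.

(** With A = f a and w = f - A, the geometric expansion has the exact remainder - w^3 / (A^3 f). It
    has order 3, since w has order 1 and 1/f is bounded near a. *)
Lemma jet2V f a : f a != 0 -> jet2 f a -> jet2 (fun z => (f z)^-1) a.
Proof.
move=> fa0 fJ; have wO := jet2_order_ge1 fJ.
pose w z := f z - f a.
have wJ : jet2 w a by apply: jet2B fJ (jet2_cst _ _).
have [eta eta0 fsmall] : exists2 eta : R, 0 < eta &
    forall z, cabs (z - a) < eta -> cabs (f a) / 2 <= cabs (f z).
  have [|eta eta0 H] := order_ge1_small (e := cabs (f a) / 2) wO.
    by rewrite divr_gt0 // cabs_gt0.
  exists eta => // z /H; have := cabsB (f z) (f z - f a).
  by rewrite opprB addrC subrK; lra.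
have VO : order_ge (fun z => (f z)^-1) 0 a.
  exists (cabs (f a) / 2)^-1, eta; split => //.
    by rewrite invr_ge0 divr_ge0 // cabs_ge0.
  move=> z /fsmall fz; rewrite expr0 mulr1 cabsV lef_pV2 // posrE.
    by apply: lt_le_trans fz; rewrite divr_gt0 // cabs_gt0.
  by rewrite divr_gt0 // cabs_gt0.
apply: (@jet2_perturb _ (fun z => (f a)^-1 - w z * (f a)^-2 + w z ^+ 2 * (f a)^-3)).
- by rewrite /w subrr !mul0r expr0n /= mul0r subr0 addr0.
- have [K [d [K0 d0 HK]]] := order_geM (order_geM (order_geM wO wO) wO)
  (order_geM (order_ge_cst ((f a)^-3) a) VO).
  exists K, (Num.min d eta); split; rewrite ?lt_min ?d0 //.
  move=> z; rewrite lt_min => /andP[zd /fsmall fz].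
  apply: le_trans (HK z zd); rewrite -cabsN le_eqVlt; apply/orP; left.
  have fz0 : f z != 0.
    by rewrite -cabs_gt0 (lt_le_trans _ fz) // divr_gt0 // cabs_gt0.
  by apply/eqP; congr cabs; rewrite /w; field; rewrite fa0 fz0.
- apply: jet2D; first apply: jet2B (jet2_cst _ _) _;
  apply: jet2M (jet2_cst _ _) => //.
  exact: jet2X.
Qed.
End Jets.

(** * The maximum principle *)

Section MaximumPrinciple.
Local Open Scope complex_scope.
Variable R : realType.
Implicit Types (f g h Q : R[i] -> R[i]) (a z : R[i]) (r : R).

Lemma disc_EVT_max (u : R[i] -> R) r : 0 <= r ->
  (forall a, cabs a <= r -> forall e, 0 < e -> exists2 eta : R, 0 < eta &
     forall z, cabs z <= r -> cabs (z - a) < eta -> `|u z - u a| < e) ->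
  exists2 a, cabs a <= r & forall z, cabs z <= r -> u z <= u a.
Proof.
move=> r0 ucont.
pose A : set (R * R) := [set p | p.1 ^+ 2 + p.2 ^+ 2 <= r ^+ 2].
pose v (p : R * R) := p.1 +i* p.2.
have Av p : A p <-> cabs (v p) <= r.
  by rewrite /A /= -(@ler_pXn2r _ 2 _ (cabs _)) ?nnegrE ?cabs_ge0 // cabs_sqr.
have cA : compact A.
  apply: (@subclosed_compact _ _ (`[- r, r] `*` `[- r, r])).
  - apply: (@preimage_closed _ _ (fun p : R * R => p.1 ^+ 2 + p.2 ^+ 2)
      [set x | x <= r ^+ 2]); last exact: closed_le.
    move=> p _; apply: cvgD; apply: (@continuous_comp _ _ _ _ (fun x :
      R => x ^+ 2)).
    + exact: cvg_fst.
    + exact: exprn_continuous.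
    + exact: cvg_snd.
    + exact: exprn_continuous.
  - by apply: compact_setX; exact: segment_compact.
  - move=> [x y] /Av /= vr; have := cabs_Re (v (x, y));
    have := cabs_Im (v (x, y)).
    by rewrite /= !in_itv /= => Hx Hy; rewrite -!ler_norml; split;
      [exact: le_trans Hy vr | exact: le_trans Hx vr].
have A0 : A !=set0 by exists (0, 0); rewrite /A /= expr0n /= addr0 sqr_ge0.
have [|p pA pmax] := @compact_EVT_max _ R (fun p => u (v p)) A A0 cA.
  apply/subspace_continuousP => p /Av pr.
  apply/cvgrPdist_lt => e e0; have [eta eta0 He] := ucont _ pr _ e0.
  rewrite near_withinE; apply/nbhs_ballP; exists (eta / 2);
    first by rewrite /= divr_gt0.
  move=> [x y] [/= bx by_] /Av qr; rewrite distrC; apply: He => //.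
  apply: le_lt_trans (cabs_le_ReIm _) _.
  rewrite /= [ltRHS](splitr eta); apply: ltrD; rewrite distrC;
    [exact: bx | exact: by_].
exists (v p); first by apply/Av; rewrite inE in pA.
move=> z zr; have := pmax (complex.Re z, complex.Im z).
by rewrite /v /= inE; case: z zr => x y zr; apply; apply/Av.
Qed.

(** Parseval on the fourth roots of unity. The cross terms involve w and w^2 up to conjugation, and
    both sum to zero over the four points; the two points s and -s would not cancel w^2. *)
Lemma quadrant_mean_sqr (A b c : R[i]) (s : R) :
  let q w := cabs (A + b * w + c * w ^+ 2) ^+ 2 in
  q s%:C + q (- s%:C) + q (s%:C * 'i) + q (- (s%:C * 'i)) =
  4 * (cabs A ^+ 2 + cabs b ^+ 2 * s ^+ 2 + cabs c ^+ 2 * s ^+ 4).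
Proof.
case: A b c => [A1 A2] [b1 b2] [c1 c2] q; rewrite /q !cabs_sqr /=.
by ring.
Qed.

Lemma sqr_cabs_ge (p e : R[i]) :
  cabs p ^+ 2 - 2 * cabs p * cabs e <= cabs (p + e) ^+ 2.
Proof.
have := cabsB (p + e) e; rewrite addrK => H.
have := cabs_ge0 (p + e); have := cabs_ge0 p; have := cabs_ge0 e.
move: (cabs p) (cabs e) (cabs (p + e)) H => x y z xyz y0 x0 z0.
by have [xy|xy] := lerP y x; nra.
Qed.

(* The mean of |h|^2 over the four points a + {s, -s, is, -is} is at least
   |h a|^2 + O(s^3), and that of |z|^2 is |a|^2 + s^2. *)
Lemma jet2_no_max h a (k d : R) : 0 < k -> 0 < d -> jet2 h a ->
  exists2 w, cabs w < d &
    cabs (h a) ^+ 2 + k * cabs a ^+ 2 < cabs (h (a + w)) ^+ 2 + k * cabs (a + w) ^+ 2.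
Proof.
move=> k0 d0 [b [c [K [eta [K0 eta0 HK]]]]].
pose P := cabs (h a) + cabs b + cabs c.
have P0 : 0 <= P by rewrite !addr_ge0 ?cabs_ge0.
(* The bound s <= 1 lets [P] dominate the quadratic part on |w| = s; the last term makes the cubic
   loss 2 P K s^3 smaller than the gain k s^2. *)
pose s := Num.min (Num.min (d / 2) (eta / 2)) (Num.min 1 (k / (2 * P * K + 1) / 2)).
have PK : 0 < 2 * P * K + 1 by rewrite ltr_wpDl // !mulr_ge0.
have s0 : 0 < s by rewrite !lt_min !divr_gt0 // ltr01.
have sd : s < d by rewrite !gt_min; apply/orP; left; apply/orP; left; lra.
have se : s < eta by rewrite !gt_min; apply/orP; left; apply/orP; right; lra.
have s1 : s <= 1 by rewrite !ge_min lexx /= orbT.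
have sk : 2 * P * K * s < k.
  have : s <= k / (2 * P * K + 1) / 2 by rewrite !ge_min lexx !orbT.
  rewrite -mulrA -invfM ler_pdivlMr ?mulr_gt0 //.
  have : 0 <= P * K * s by rewrite !mulr_ge0 // ltW.
  nra.
pose p w := h a + b * w + c * w ^+ 2.
have Hw w : cabs w = s -> cabs (p w) ^+ 2 - 2 * P * K * s ^+ 3
  <= cabs (h (a + w)) ^+ 2.
  move=> ws; have := HK (a + w); rewrite addrAC subrr add0r ws => /(_ se).
  set e := h (a + w) - _ => He.
  have -> : h (a + w) = p w + e by rewrite /e /p; ring.
  apply: le_trans (sqr_cabs_ge _ _); rewrite lerD2l lerN2 -!mulrA ler_wpM2l // .
  apply: ler_pM; rewrite ?cabs_ge0 //.
  apply: le_trans (cabsD _ _) _; apply: lerD; last first.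
    by rewrite cabsM cabsX ws ler_piMr ?cabs_ge0 // expr_le1 // ltW.
  apply: le_trans (cabsD _ _) _; apply: lerD => //.
  by rewrite cabsM ws ler_piMr ?cabs_ge0.
have ws1 : cabs s%:C = s by rewrite cabs_real ger0_norm // ltW.
have ws2 : cabs (- s%:C) = s by rewrite cabsN.
have ws3 : cabs (s%:C * 'i) = s by rewrite cabsM cabs_i mulr1.
have ws4 : cabs (- (s%:C * 'i)) = s by rewrite cabsN.
have := quadrant_mean_sqr (h a) b c s.
have := quadrant_mean_sqr a 1 0 s.
rewrite /= !mul0r !addr0 !mul1r cabs1 cabs0 expr1n expr0n /= mul1r mul0r addr0.
rewrite -!/(p _) => Ma Mh.
have Bs : 0 <= cabs b ^+ 2 * s ^+ 2 by rewrite mulr_ge0 ?sqr_ge0.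
have Cs : 0 <= cabs c ^+ 2 * s ^+ 4
  by rewrite mulr_ge0 ?sqr_ge0 // exprn_even_ge0.
have Ks : 2 * P * K * s ^+ 3 < k * s ^+ 2.
  by rewrite [s ^+ 3]exprS mulrA ltr_pM2r // exprn_gt0.
apply: contrapT => Hno.
have Hle w : cabs w = s ->
    cabs (h (a + w)) ^+ 2 + k * cabs (a + w) ^+ 2
      <= cabs (h a) ^+ 2 + k * cabs a ^+ 2.
  by move=> ws; rewrite leNgt; apply/negP => lt; apply: Hno; exists w;
    rewrite ?ws.
have := Hw _ ws1; have := Hw _ ws2; have := Hw _ ws3; have := Hw _ ws4.
have := Hle _ ws1; have := Hle _ ws2; have := Hle _ ws3; have := Hle _ ws4.
have : k * (cabs (a + s%:C) ^+ 2 + cabs (a - s%:C) ^+ 2 + cabs (a + s%:C * 'i) ^+ 2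
  + cabs (a - s%:C * 'i) ^+ 2) = k * (4 * (cabs a ^+ 2 + s ^+ 2)) by rewrite Ma.
move=> E; rewrite !mulrDr in E; move: E.
move: Ks; rewrite ltNge => /negP Ks *; apply: Ks; lra.
Qed.

(** |h|^2 + k' |z|^2 attains its maximum on the closed disc, and [jet2_no_max] excludes an interior
    point where h has a jet. At a zero of h the bound is immediate, and allowing such points without
    a jet is what makes quotients extended by 0 admissible. *)
Theorem maximum_principle h r (B : R) : 0 < r ->
  (forall a, cabs a <= r -> forall e, 0 < e -> exists2 eta : R, 0 < eta &
     forall z, cabs z <= r -> cabs (z - a) < eta -> cabs (h z - h a) < e) ->
  (forall a, cabs a < r -> h a = 0 \/ jet2 h a) ->
  (forall z, cabs z = r -> cabs (h z) <= B) ->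
  forall z, cabs z <= r -> cabs (h z) <= B.
Proof.
move=> r0 hcont hjet hB z zr.
have B0 : 0 <= B.
  have rr : cabs (r%:C) = r by rewrite cabs_real ger0_norm // ltW.
  exact: le_trans (cabs_ge0 _) (hB _ rr).
suff H k : 0 < k -> cabs (h z) ^+ 2 <= B ^+ 2 + k.
  rewrite -(@ler_pXn2r _ 2) ?nnegrE ?cabs_ge0 //.
  by apply/ler_addgt0Pr => k k0; exact: H.
(* With this weight the perturbation k' |z|^2 is at most k on the disc. *)
move=> k0; pose k' := k / r ^+ 2.
have k'0 : 0 < k' by rewrite divr_gt0 // exprn_gt0.
have k'r : k' * r ^+ 2 = k by rewrite /k' divfK // expf_neq0 // gt_eqF.
clearbody k'.
have [a ar amax] : exists2 a, cabs a <= r & forall z, cabs z <= r ->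
    cabs (h z) ^+ 2 + k' * cabs z ^+ 2 <= cabs (h a) ^+ 2 + k' * cabs a ^+ 2.
  apply: disc_EVT_max; first exact: ltW.
  move=> a ar e e0.
  pose H := 2 * cabs (h a) + 1; have H0 : 0 < H.
    by rewrite ltr_wpDl // mulr_ge0 // cabs_ge0.
  have [|eta eta0 He] := hcont _ ar (Num.min 1 (e / 2 / H)).
    by rewrite lt_min ltr01 !divr_gt0.
  have e20 : 0 < e / 2 / (k' * (2 * r)) by rewrite !divr_gt0 // !mulr_gt0.
  exists (Num.min eta (e / 2 / (k' * (2 * r)))); first by rewrite lt_min eta0.
  move=> w wr; rewrite lt_min => /andP[/(He _ wr)];
    rewrite lt_min => /andP[h1 h2] wa.
  have E1 : `|cabs (h w) ^+ 2 - cabs (h a) ^+ 2| < e / 2.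
    have D : `|cabs (h w) - cabs (h a)| <= cabs (h w - h a).
      have := cabsD (h w - h a) (h a); have := cabsD (h a - h w) (h w).
      by rewrite !subrK (cabsC (h a)) ler_norml; lra.
    rewrite subr_sqr normrM; apply: le_lt_trans (_ : cabs (h w - h a) * H < _).
      apply: ler_pM => //; rewrite ger0_norm ?addr_ge0 ?cabs_ge0 // /H.
      by have := ler_norml (cabs (h w) - cabs (h a)) 1;
        rewrite (le_trans D (ltW h1)); lra.
    by rewrite -ltr_pdivlMr.
  have E2 : `|k' * cabs w ^+ 2 - k' * cabs a ^+ 2| < e / 2.
    have D : `|cabs w - cabs a| <= cabs (w - a).
      have := cabsD (w - a) a; have := cabsD (a - w) w.
      by rewrite !subrK (cabsC a) ler_norml; lra.
    rewrite -mulrBr normrM (ger0_norm (ltW k'0)) subr_sqr normrM mulrCA.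
    apply: le_lt_trans (_ : cabs (w - a) * (k' * (2 * r)) < _).
      apply: ler_pM => //; rewrite ?mulr_ge0 ?(ltW k'0) //.
      rewrite ler_pM2l // ger0_norm ?addr_ge0 ?cabs_ge0 //; lra.
    by rewrite -ltr_pdivlMr // !mulr_gt0.
  rewrite opprD addrACA; apply: le_lt_trans (ler_normD _ _) _; lra.
have k'a : k' * cabs a ^+ 2 <= k.
  by rewrite -k'r ler_pM2l // ler_pXn2r ?nnegrE ?cabs_ge0 // ltW.
have k'z : 0 <= k' * cabs z ^+ 2 by rewrite mulr_ge0 ?sqr_ge0 // ltW.
have Hz := amax _ zr.
move: ar; rewrite le_eqVlt => /predU1P[ra|ra].
  have : cabs (h a) ^+ 2 <= B ^+ 2 by rewrite ler_pXn2r ?nnegrE ?cabs_ge0 // hB.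
  lra.
have [ha0|haJ] := hjet _ ra.
  by move: Hz; rewrite ha0 cabs0 expr0n /= ; have := sqr_ge0 B; lra.
have ra' : 0 < r - cabs a by rewrite subr_gt0.
have [w wd Hw] := jet2_no_max k'0 ra' haJ.
have /amax : cabs (a + w) <= r by apply: le_trans (cabsD _ _) _; lra.
by rewrite leNgt Hw.
Qed.

(** This is the extraction of n-th roots without roots: if x > B > 0, Bernoulli makes (x / B)^n grow
    at least linearly, while c x (x / B)^n <= G. *)
Lemma expr_ratio_le (x B c G : R) : 0 <= x -> 0 <= B -> 0 < c ->
  (forall n, c * x ^+ n.+1 <= B ^+ n * G) -> x <= B.
Proof.
move=> x0 B0 c0 H; rewrite leNgt; apply/negP => Bx.
have {}x0 : 0 < x by exact: le_lt_trans Bx.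
have [B00|Bn0] := eqVneq B 0.
  have := H 1%N; rewrite B00 expr1 mul0r leNgt mulr_gt0 //.
  by rewrite exprn_gt0.
have {Bn0}B0 : 0 < B by rewrite lt_def Bn0.
pose q := x / B - 1.
have q0 : 0 < q by rewrite /q subr_gt0 ltr_pdivlMr ?mul1r.
have Hq n : 1 + n%:R * q <= (x / B) ^+ n.
  elim: n => [|n IHn]; first by rewrite mul0r addr0 expr0.
  have xB : x / B = 1 + q by rewrite /q addrC subrK.
  rewrite xB in IHn *; rewrite exprS.
  have nq : 0 <= n%:R * q ^+ 2 by rewrite mulr_ge0 ?sqr_ge0.
  apply: (@le_trans _ _ ((1 + q) * (1 + n%:R * q))).
    by rewrite -natr1; nra.
  by rewrite ler_wpM2l // addr_ge0 // ltW.
have cxq : 0 < c * x * q by rewrite !mulr_gt0.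
pose n := Num.bound (G / (c * x * q)).
have Hn : G / (c * x * q) < n%:R.
  have [G0|G0] := lerP 0 (G / (c * x * q)); first exact: archi_boundP.
  by apply: lt_le_trans G0 _.
have := H n; rewrite leNgt => /negP; apply.
apply: (@lt_le_trans _ _ (B ^+ n * (c * x * (n%:R * q)))).
  rewrite ltr_pM2l ?exprn_gt0 //; move: Hn; rewrite ltr_pdivrMr //; lra.
have -> : c * x ^+ n.+1 = B ^+ n * (c * x * (x / B) ^+ n).
  by rewrite expr_div_n exprS; field; rewrite ?expf_neq0 ?gt_eqF.
rewrite ler_pM2l ?exprn_gt0 // ler_pM2l ?mulr_gt0 //.
by apply: le_trans (Hq n); rewrite lerDr.
Qed.

Lemma jet2_continuous h a : jet2 h a -> forall e, 0 < e ->
  exists2 eta : R, 0 < eta & forall z, cabs (z - a) < eta ->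
    cabs (h z - h a) < e.
Proof. by move=> /jet2_order_ge1 hO e; exact: order_ge1_small. Qed.

(* The maximum principle applies to g^(n+1) / Q^n, which tends to 0 at the zeros
   of Q; the bound on g / Q follows
     by taking n-th roots as n tends to infinity. *)
Theorem quotient_maximum g Q r (B : R) : 0 < r -> 0 <= B ->
  (forall a, cabs a <= r -> jet2 g a) -> (forall a, cabs a <= r -> jet2 Q a) ->
  (forall z, cabs z = r -> Q z != 0 /\ cabs (g z) <= B * cabs (Q z)) ->
  (forall a, cabs a < r -> Q a = 0 -> exists2 K : R, 0 <= K &
     exists2 eta, 0 < eta &
     forall z, cabs (z - a) < eta -> cabs (g z) <= K * cabs (Q z)) ->
  forall z, cabs z <= r -> cabs (g z) <= B * cabs (Q z).
Proof.
move=> r0 B0 gJ QJ bd zero z zr.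
have g0 a : cabs a < r -> Q a = 0 -> g a = 0.
  move=> ar Qa; have [K _ [eta eta0 H]] := zero _ ar Qa.
  have := H a; rewrite subrr cabs0 Qa cabs0 mulr0 => /(_ eta0) ga.
  by apply/eqP; rewrite -cabs_eq0 eq_le ga cabs_ge0.
have [Qz|Qz] := eqVneq (Q z) 0.
  have {}zr : cabs z < r.
    by rewrite lt_neqAle zr andbT; apply/eqP => /bd[]; rewrite Qz eqxx.
  by rewrite Qz g0 // cabs0 mulr0.
have [m mr mmax] : exists2 m, cabs m <= r & forall w, cabs w <= r ->
  cabs (g w) <= cabs (g m).
  apply: (@disc_EVT_max (fun w => cabs (g w))); first exact: ltW.
  move=> a ar e e0; have [eta eta0 H] := jet2_continuous (gJ _ ar) e0.
  exists eta => // w _ /H; apply: le_lt_trans.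
  have := cabsD (g w - g a) (g a); have := cabsD (g a - g w) (g w).
  by rewrite !subrK (cabsC (g a)) ler_norml; lra.
(* Since |h| = |g / Q|^n |g| <= K^n |g| near a zero of Q, the spare factor g forces h to 0 there.
   This agrees with the value of the formula, which is 0 because g vanishes too. *)
pose h n w := g w ^+ n.+1 * (Q w ^+ n)^-1.
have hE n w : cabs (h n w) = (cabs (g w) / cabs (Q w)) ^+ n * cabs (g w).
  by rewrite /h cabsM cabsV !cabsX exprSr expr_div_n mulrAC.
have hmax n w : cabs w <= r -> cabs (h n w) <= B ^+ n * cabs (g m).
  apply: maximum_principle => //.
  - move=> a ar; have [Qa|Qa] := eqVneq (Q a) 0; last first.
      move=> e e0; have hJ : jet2 (h n) a.
        apply: jet2M; first by apply: jet2X; exact: gJ.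
        by apply: jet2V; [rewrite expf_neq0|apply: jet2X; exact: QJ].
      have [eta eta0 H] := jet2_continuous hJ e0.
      by exists eta => // v _ /H.
    have {}ar : cabs a < r.
      by rewrite lt_neqAle ar andbT; apply/eqP => /bd[]; rewrite Qa eqxx.
    have [K K0 [eta eta0 H]] := zero _ ar Qa => e e0.
    have eK : 0 < e / (K ^+ n + 1) by rewrite divr_gt0 // ltr_wpDl // exprn_ge0.
    have [d d0 Hd] := jet2_continuous (gJ _ (ltW ar)) eK.
    exists (Num.min eta d); first by rewrite lt_min eta0.
    move=> v _; rewrite lt_min => /andP[/H gv /Hd].
    have -> : h n a = 0 by rewrite /h (g0 a) // expr0n mul0r.
    rewrite (g0 a) // !subr0 ltr_pdivlMr ?ltr_wpDl ?exprn_ge0 // hE.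
    apply: le_lt_trans; rewrite mulrC ler_wpM2l ?cabs_ge0 //.
    apply: (@le_trans _ _ (K ^+ n)); last by rewrite lerDl.
    rewrite lerXn2r ?nnegrE ?divr_ge0 ?cabs_ge0 //.
    have [Qv|Qv] := eqVneq (Q v) 0; first by rewrite Qv cabs0 invr0 mulr0.
    by rewrite ler_pdivrMr // cabs_gt0.
  - move=> a ar; have [Qa|Qa] := eqVneq (Q a) 0.
      by left; rewrite /h (g0 a) // expr0n mul0r.
    right; apply: jet2M; first by apply: jet2X; exact: gJ (ltW ar).
    by apply: jet2V; [rewrite expf_neq0|apply: jet2X; exact: QJ (ltW ar)].
  - move=> v vr; have [Qv gv] := bd _ vr; rewrite hE.
    apply: ler_pM; rewrite ?exprn_ge0 ?divr_ge0 ?cabs_ge0 //;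
      last by apply: mmax; rewrite vr.
    by rewrite lerXn2r ?nnegrE ?divr_ge0 ?cabs_ge0 // ler_pdivrMr ?cabs_gt0.
rewrite -ler_pdivrMr ?cabs_gt0 //.
apply: (@expr_ratio_le _ _ (cabs (Q z)) (cabs (g m))) => //.
- by rewrite divr_ge0 ?cabs_ge0.
- by rewrite cabs_gt0.
- move=> n; have := hmax n z zr; rewrite hE; apply: le_trans.
  by rewrite mulrC exprSr -mulrA divfK // cabs_eq0.
Qed.

End MaximumPrinciple.

Section SchwarzLemmas.
Local Open Scope complex_scope.
Variable R : realType.
Implicit Types (g : R[i] -> R[i]) (z : R[i]) (r B : R).

(** [quotient_maximum] with Q = z^k; the hypothesis [order_ge g k 0] is the local bound |g| <= K |Q|
    at the only zero of Q. *)
Lemma schwarz_pow g k r B : 0 < r -> 0 <= B ->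
  (forall a, cabs a <= r -> jet2 g a) ->
  (forall z, cabs z = r -> cabs (g z) <= B) -> order_ge g k 0 ->
  forall z, cabs z <= r -> cabs (g z) <= B * (cabs z / r) ^+ k.
Proof.
move=> r0 B0 gJ gB [K [eta [K0 eta0 gO]]] z zr.
have rk : 0 < r ^+ k by rewrite exprn_gt0.
rewrite expr_div_n mulrA mulrAC -cabsX.
apply: (@quotient_maximum _ g (fun z => z ^+ k) r) => //.
- by rewrite divr_ge0 // ltW.
- by move=> a _; apply: jet2X; exact: jet2_id.
- move=> w wr; rewrite expf_neq0; last by rewrite -cabs_gt0 wr.
  by rewrite cabsX wr divfK ?gt_eqF // gB.
- move=> a _ /eqP; rewrite expf_eq0 => /andP[_ /eqP ->].
  by exists K => //; exists eta => // w /gO; rewrite subr0 cabsX.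
Qed.

Lemma schwarz_zero g r B : 0 < r -> 0 <= B ->
  (forall a, cabs a <= r -> jet2 g a) ->
  (forall z, cabs z = r -> cabs (g z) <= B) -> g 0 = 0 ->
  forall z, cabs z <= r -> cabs (g z) <= B * (cabs z / r).
Proof.
move=> r0 B0 gJ gB g0 z zr; rewrite -[cabs z / r]expr1;
  apply: schwarz_pow => //.
have J0 : jet2 g 0 by apply: gJ; rewrite cabs0 ltW.
by apply: eq_order_ge (jet2_order_ge1 J0) => w; rewrite g0 subr0.
Qed.

End SchwarzLemmas.

(** * The maximum norm and holomorphic curves in C^d *)

Section MaxNorm.
Local Open Scope complex_scope.
Variables (R : realType) (d : nat).
Implicit Types (x y v : Cd R d).

Lemma norm_vnorm x : `|x| = (vnorm x)%:C.
Proof. by rewrite /vnorm RRe_real // normr_real. Qed.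

Lemma vnorm_ge0 x : 0 <= vnorm x.
Proof. by rewrite -ler0c -norm_vnorm. Qed.

Lemma vnorm0 : vnorm (0 : Cd R d) = 0.
Proof. by rewrite /vnorm normr0. Qed.

Lemma vnorm_eq0 x : vnorm x = 0 -> x = 0.
Proof. by move=> x0; apply/eqP; rewrite -normr_eq0 norm_vnorm x0. Qed.

Lemma vnormD x y : vnorm (x + y) <= vnorm x + vnorm y.
Proof. by rewrite -lecR rmorphD /= -!norm_vnorm ler_normD. Qed.

Lemma vnormN x : vnorm (- x) = vnorm x.
Proof. by rewrite /vnorm normrN. Qed.

Lemma vnormB x y : vnorm (x - y) <= vnorm x + vnorm y.
Proof. by rewrite -(vnormN y) vnormD. Qed.

Lemma vnormC x y : vnorm (x - y) = vnorm (y - x).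
Proof. by rewrite -vnormN opprB. Qed.

Lemma vnorm_triangle y x v : vnorm (x - v) <= vnorm (x - y) + vnorm (y - v).
Proof. by rewrite -[x - v](subrKA y) vnormD. Qed.

Lemma vnormZ (c : R[i]) x : vnorm (c *: x) = cabs c * vnorm x.
Proof.
by apply: complexI; rewrite rmorphM /= -norm_vnorm -normc_cabs -norm_vnorm normrZ.
Qed.

Lemma cabs_coord x j : cabs (x 0 j) <= vnorm x.
Proof.
rewrite -lecR -normc_cabs -norm_vnorm [leRHS]/Num.norm /= mx_normE.
by rewrite -[leLHS]nngE num_le; apply/bigmax_geP; right; exists (0, j).
Qed.

Lemma vnorm_le x (B : R) : 0 <= B -> (forall j, cabs (x 0 j) <= B) ->
  vnorm x <= B.
Proof.
move=> B0 xB; rewrite -lecR -norm_vnorm.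
have -> : `|x| = mx_norm x by [].
have [->|/mx_norm_neq0[[i j] /= ->]] := eqVneq (mx_norm x) 0;
  first by rewrite lecR.
by rewrite (ord1 i) normc_cabs lecR.
Qed.

Lemma vnorm_sum (I : Type) (s : seq I) (P : pred I) (f : I -> Cd R d) :
  vnorm (\sum_(i <- s | P i) f i) <= \sum_(i <- s | P i) vnorm (f i).
Proof.
elim/big_rec2: _ => [|i y z _ le_yz]; first by rewrite vnorm0.
by rewrite (le_trans (vnormD _ _)) // lerD2l.
Qed.

End MaxNorm.

Section Holomorphic.
Local Open Scope complex_scope.
Variables (R : realType) (d : nat).
Implicit Types (F : Cd R d -> Cd R d) (x y h : Cd R d) (a : R[i]).

Definition jet2v (z : R[i] -> Cd R d) a := forall j, jet2 (fun s => z s 0 j) a.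

(* Holomorphy of F at x, tested on the curves through x. *)
Definition hol_at F x := forall (z : R[i] -> Cd R d) a,
  z a = x -> jet2v z a -> jet2v (fun s => F (z s)) a.

Lemma jet2v_order_ge1 z a : jet2v z a ->
  exists2 K : R, 0 <= K & exists2 eta : R, 0 < eta &
    forall s, cabs (s - a) < eta -> vnorm (z s - z a) <= K * cabs (s - a).
Proof.
move=> zJ.
have /choice[Ke HKe] (j : 'I_d) : exists p : R * R, [/\ 0 <= p.1, 0 < p.2 &
    forall s, cabs (s - a) < p.2 ->
      cabs (z s 0 j - z a 0 j) <= p.1 * cabs (s - a)].
  have [K [eta [K0 eta0 H]]] := jet2_order_ge1 (zJ j).
  by exists (K, eta).
exists (\sum_j (Ke j).1); first by apply: sumr_ge0 => j _; have [] := HKe j.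
exists (\big[Num.min/1]_j (Ke j).2).
  by apply: lt_bigmin => // j _; have [] := HKe j.
move=> s /bigmin_gtP[_ sK].
apply: vnorm_le => [|j].
  by rewrite mulr_ge0 ?cabs_ge0 // sumr_ge0 // => j _; have [] := HKe j.
have [K0 _ H] := HKe j; rewrite !mxE; apply: le_trans (H s _) _;
  first exact: sK.
rewrite ler_wpM2r ?cabs_ge0 // (bigD1 j) //= lerDl sumr_ge0 // => i _.
by have [] := HKe i.
Qed.

End Holomorphic.

(** * Analytic maps preserve second order jets *)

Section AbsoluteConvergence.
Local Open Scope complex_scope.
Variables (R : realType) (I : choiceType).
Implicit Types (A K : {fset I}).

(** On the terms of one sign, the sum of absolute values is the absolute value of a sum, hence at
    most B; there are two signs. *)
Lemma real_abs_sum_le A0 (u : I -> R) (B : R) :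
  (forall K, (forall i, i \in K -> i \notin A0) -> `|\sum_(i <- K) u i| <= B) ->
  forall K, (forall i, i \in K -> i \notin A0) -> \sum_(i <- K) `|u i| <= 2 * B.
Proof.
move=> H K KA0; rewrite (big_fsetID _ (fun i => 0 <= u i)) /=.
have sub (P : pred I) i : i \in [fset x | x in K & P x]%fset -> i \notin A0.
  by rewrite !inE => /andP[/KA0].
rewrite mulr2n mulrDl mul1r; apply: lerD.
  apply: le_trans (H _ (sub (fun i => 0 <= u i))); apply: le_trans (ler_norm _).
  rewrite !big_seq; apply: ler_sum => i.
  by rewrite !inE => /andP[_ /= ui]; rewrite ger0_norm.
apply: le_trans (H _ (sub (fun i => ~~ (0 <= u i)))); rewrite -normrN -sumrN.
apply: le_trans (ler_norm _).
rewrite !big_seq; apply: ler_sum => i.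
by rewrite !inE -ltNge => /andP[_ /= ui]; rewrite ltr0_norm.
Qed.

(** Passes from unconditional to absolute convergence: convergence along finite sets bounds every
    finite sum that avoids some fixed [A0]. The real and imaginary parts cost 2 B each. *)
Lemma abs_sum_bounded A0 (c : I -> R[i]) (B : R) : 0 <= B ->
  (forall K, (forall i, i \in K -> i \notin A0) ->
    cabs (\sum_(i <- K) c i) <= B) ->
  exists2 C : R, 0 <= C & forall A, \sum_(i <- A) cabs (c i) <= C.
Proof.
move=> B0 H; exists (\sum_(i <- A0) cabs (c i) + (2 * B + 2 * B)).
  by rewrite !addr_ge0 ?mulr_ge0 // sumr_ge0 // => i _; exact: cabs_ge0.
move=> A; rewrite (big_fsetID _ (mem A0)) /=; apply: lerD.
  rewrite [leRHS](big_fsetID _ (mem A)) /= (_ : [fset x | x in A &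
    x \in A0]%fset =
    [fset x | x in A0 & x \in A]%fset); last by apply/fsetP => i;
      rewrite !inE andbC.
  by rewrite lerDl sumr_ge0 // => i _; exact: cabs_ge0.
set K := [fset x | x in A & x \notin A0]%fset.
have KA0 i : i \in K -> i \notin A0 by rewrite !inE => /andP[].
apply: (@le_trans _ _ (\sum_(i <- K) (`|complex.Re (c i)| + `|complex.Im (c i)|))).
  by apply: ler_sum => i _; exact: cabs_le_ReIm.
rewrite big_split /=; apply: lerD; apply: (@real_abs_sum_le A0) => // J JA0.
  by rewrite -(raddf_sum (@complex.Re R : Rcomplex R ->
    R)) (le_trans (cabs_Re _)) // H.
by rewrite -(raddf_sum (@complex.Im R : Rcomplex R ->
  R)) (le_trans (cabs_Im _)) // H.
Qed.

End AbsoluteConvergence.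

Section AnalyticHolomorphic.
Local Open Scope complex_scope.
Variables (R : realType) (d : nat).
Implicit Types (F : Cd R d -> Cd R d) (x h : Cd R d).
Let I := {ffun 'I_d -> nat}.

Lemma totally_cvg_lim (J : choiceType) (f : J ->
  Cd R d) (l : Cd R d) (e : R) : 0 < e ->
  summability.partial_sum f @ summability.totally --> l ->
  exists A0 : {fset J}, forall A : {fset J}, (A0 `<=` A)%fset ->
    vnorm (l - \sum_(i <- A) f i) < e.
Proof.
move=> e0; have e0' : 0 < e%:C by rewrite ltcR.
move=> /cvgrPdist_lt H; have [A0 _ {}H] := H (@filter_filter _ _ summability.totally_filter) _ e0'.
exists A0 => A /H /=; rewrite norm_vnorm ltcR.
by rewrite /summability.partial_sum -(big_seq_fsetE _ A xpredT f).
Qed.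

Lemma cabs_monomial h (a : I) :
  cabs (monomial h a) = \prod_j cabs (h 0 j) ^+ a j.
Proof.
rewrite /monomial; elim/big_rec2: _ => [|j z w _ <-]; first exact: cabs1.
by rewrite cabsM cabsX.
Qed.

(* Contains all indices of total degree at most 2; any other index has total
   degree at least 3. *)
Definition low_degree : {fset I} :=
  [fset ([ffun j => (b j : nat)] : I) | b : {ffun 'I_d ->
    'I_3} in enum {ffun 'I_d -> 'I_3}]%fset.

Lemma low_degreeP (a : I) : a \notin low_degree -> exists j, (3 <= a j)%N.
Proof.
move=> aJ; apply: contrapT => Hno; move/negP: aJ; apply.
have a3 j : (a j < 3)%N by rewrite ltnNge; apply/negP => ?; apply: Hno;
  exists j.
apply/imfsetP; exists [ffun j => Ordinal (a3 j)]; first by rewrite /= mem_enum.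
by apply/ffunP => j; rewrite !ffunE.
Qed.

(** Truncation by partial degrees keeps some monomials of total degree above 2. This is harmless,
    because every polynomial preserves jets. *)
Definition taylor_part (c : I -> Cd R d) h : Cd R d :=
  \sum_(a <- low_degree) monomial h a *: c a.

(** The series converges absolutely at h0 = (rho, ..., rho). For |h| = q rho with q <= 1, a monomial
    with some exponent at least 3 is at most q^3 times its value at h0, so the tail is at most a
    constant times q^3. *)
Lemma analytic_taylor F x : analytic_at F x ->
  exists (c : I -> Cd R d) (K rho : R), [/\ 0 <= K, 0 < rho &
    forall h, vnorm h <= rho -> vnorm (F (x + h) - taylor_part c h)
      <= K * vnorm h ^+ 3].
Proof.
move=> [r [c [r0 Hc]]]; pose rho := r / 2.
have rho0 : 0 < rho by rewrite divr_gt0.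
have rhor : rho < r by rewrite /rho; lra.
clearbody rho.
pose h0 : Cd R d := const_mx rho%:C.
have h0r : vnorm h0 < r.
  apply: le_lt_trans rhor; apply: vnorm_le => [|j]; first exact: ltW.
  by rewrite mxE cabs_real ger0_norm // ltW.
have mon0 (a : I) : cabs (monomial h0 a) = \prod_j rho ^+ a j.
  rewrite cabs_monomial; apply: eq_bigr => j _.
  by rewrite mxE cabs_real ger0_norm // ltW.
have [A0 HA0] := totally_cvg_lim ltr01 (Hc _ h0r).
(* The sums over [A0] and over its union with [K] are both within 1 of the limit, so they differ by
   at most 2. *)
have disj (K : {fset I}) : (forall a, a \in K -> a \notin A0) ->
    vnorm (\sum_(a <- K) monomial h0 a *: c a) <= 2.
  move=> KA0.
  have := HA0 (A0 `|` K)%fset (fsubsetUl _ _); have := HA0 A0 (fsubset_refl _).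
  rewrite (big_fsetID _ (mem A0) (A0 `|` K)%fset) /=.
  have -> : [fset a | a in (A0 `|` K)%fset & a \in A0]%fset = A0.
    by apply/fsetP => a; rewrite !inE; case: (a \in A0); rewrite ?andbF.
  have -> : [fset a | a in (A0 `|` K)%fset & a \notin A0]%fset = K.
    apply/fsetP => a; rewrite !inE; have := KA0 a.
    by case: (a \in K) => [/(_ isT) ->|_]; case: (a \in A0).
  set l := F _; set S0 := \sum_(i <- A0) _; set S := \sum_(i <- K) _ => H1 H2.
  have -> : S = (l - S0) - (l - (S0 + S))
    by rewrite opprB addrC addrA subrK addrAC subrr add0r.
  by apply: le_trans (vnormB _ _) _; lra.
have /choice[C HC] j : exists Cj : R, 0 <= Cj /\ forall A : {fset I},
    \sum_(a <- A) cabs (monomial h0 a * c a 0 j) <= Cj.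
  have [|K KA0|Cj Cj0 H] := @abs_sum_bounded R I A0 (fun a => monomial h0 a * c a 0 j) 2.
  - by [].
  - apply: le_trans (disj K KA0); apply: le_trans (cabs_coord _ j).
    by rewrite summxE; under [X in _ <= cabs X]eq_bigr do rewrite mxE.
  - by exists Cj.
pose B := \sum_j C j.
have B0 : 0 <= B by apply: sumr_ge0 => j _; case: (HC j).
exists c, (B / rho ^+ 3), rho; split => //;
  first by rewrite divr_ge0 // exprn_ge0 // ltW.
move=> h hrho; set q := vnorm h / rho.
have q0 : 0 <= q by rewrite divr_ge0 ?vnorm_ge0 // ltW.
have q1 : q <= 1 by rewrite ler_pdivrMr // mul1r.
have qrho : q * rho = vnorm h by rewrite divfK // gt_eqF.
have hmon (a : I) : a \notin low_degree ->
  cabs (monomial h a) <= q ^+ 3 * cabs (monomial h0 a).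
  move=> /low_degreeP[j aj].
  rewrite mon0 cabs_monomial.
  apply: (@le_trans _ _ (\prod_i (q * rho) ^+ a i)).
    apply: ler_prod => i _; rewrite exprn_ge0 ?cabs_ge0 //=.
    by rewrite lerXn2r ?nnegrE ?cabs_ge0 // ?qrho ?vnorm_ge0 // cabs_coord.
  under eq_bigr do rewrite exprMn.
  rewrite big_split /= ler_wpM2r //.
    by apply: prodr_ge0 => i _; rewrite exprn_ge0 // ltW.
  rewrite (bigD1 j) //= -[leRHS]mulr1; apply: ler_pM => //.
  - exact: exprn_ge0.
  - by apply: prodr_ge0 => i _; exact: exprn_ge0.
  - exact: ler_wiXn2l.
  - by apply: prodr_ile1 => i _; rewrite exprn_ge0 //= exprn_ile1.
have -> : B / rho ^+ 3 * vnorm h ^+ 3 = B * q ^+ 3.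
  by rewrite /q; field; rewrite gt_eqF.
apply: vnorm_le => [|j]; first by rewrite mulr_ge0 // exprn_ge0.
(* The limit is replaced by a finite sum containing all of [low_degree], at the price of an
   arbitrary e; what remains is a finite tail. *)
apply/ler_addgt0Pr => e e0.
have [A1 HA1] := totally_cvg_lim e0 (Hc _ (le_lt_trans hrho rhor)).
have /ltW := HA1 (low_degree `|` A1)%fset (fsubsetUr _ _).
rewrite (big_fsetID _ (mem low_degree) (low_degree `|` A1)%fset) /=.
have -> : [fset a | a in (low_degree `|` A1)%fset &
  a \in low_degree]%fset = low_degree.
  by apply/fsetP => a; rewrite !inE; case: (a \in low_degree); rewrite ?andbF.
rewrite -/(taylor_part c h).
set A := [fset a | a in _ & _]%fset; set T := \sum_(a <- A) _ => HT.
have -> : F (x + h) - taylor_part c h = T + (F (x + h) - (taylor_part c h + T)).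
  by rewrite [RHS]addrC opprD addrA subrK.
rewrite mxE; apply: le_trans (cabsD _ _) _; apply: lerD; last first.
  exact: le_trans (cabs_coord _ j) HT.
rewrite /T summxE; apply: le_trans (cabs_sum _ _ _) _.
apply: (@le_trans _ _ (\sum_(a <- A) q ^+ 3 * cabs (monomial h0 a * c a 0 j))).
  rewrite !big_seq; apply: ler_sum => a; rewrite !inE => /andP[_ aJ].
  by rewrite mxE !cabsM mulrA ler_wpM2r ?cabs_ge0 // hmon.
rewrite -mulr_sumr mulrC ler_wpM2r ?exprn_ge0 //.
have [Cj0 HCj] := HC j; apply: le_trans (HCj A) _.
rewrite /B (bigD1 j) //= lerDl sumr_ge0 // => i _.
by have [] := HC i.
Qed.

(** Along a curve with |z s - x| <= L |s - a|, the cubic Taylor remainder becomes K L^3 |s - a|^3,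
    which a second order jet ignores. *)
Lemma analytic_hol F x : analytic_at F x -> hol_at F x.
Proof.
move=> /analytic_taylor[c [K [rho [K0 rho0 HK]]]] z a zax zJ j.
have F0 : F x = taylor_part c 0.
  have := HK 0; rewrite addr0 vnorm0 expr0n /= mulr0 => /(_ (ltW rho0)) H.
  by apply/eqP; rewrite -subr_eq0; apply/eqP/vnorm_eq0/eqP;
    rewrite eq_le H vnorm_ge0.
apply: (@jet2_perturb _ _ (fun s => taylor_part c (z s - x) 0 j)).
- by rewrite zax subrr F0.
- have [L L0 [eta eta0 HL]] := jet2v_order_ge1 zJ.
  exists (K * L ^+ 3), (Num.min eta (rho / (L + 1))); split.
  + by rewrite mulr_ge0 // exprn_ge0.
  + by rewrite lt_min eta0 divr_gt0 // ltr_wpDl.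
  move=> s; rewrite lt_min => /andP[/HL]; rewrite zax => zs.
  rewrite ltr_pdivlMr ?ltr_wpDl // => sL.
  have zrho : vnorm (z s - x) <= rho.
    apply: le_trans zs _; apply: le_trans (ltW sL); rewrite mulrC.
    by rewrite ler_wpM2l ?cabs_ge0 // lerDl.
  have := HK _ zrho; rewrite [x + _]addrC subrK => H.
  have -> : F (z s) 0 j - taylor_part c (z s - x) 0 j = (F (z s) - taylor_part c (z s - x)) 0 j.
    by rewrite !mxE.
  apply: le_trans (cabs_coord _ j) _; apply: le_trans H _.
  rewrite -mulrA -exprMn ler_wpM2l //.
  by rewrite lerXn2r ?nnegrE ?vnorm_ge0 ?mulr_ge0 ?cabs_ge0.
- apply: (@eq_jet2 _ (fun s => \sum_(b <- low_degree) (\prod_i (z s 0 i - x 0 i)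
  ^+ b i) * c b 0 j)).
    move=> s; rewrite /taylor_part summxE; apply: eq_bigr => b _.
    by rewrite mxE; congr (_ * _); apply: eq_bigr => i _; rewrite !mxE.
  apply: jet2_sum => b _; apply: jet2M (jet2_cst _ _).
  apply: jet2_prod => i _; apply: jet2X; apply: jet2B (zJ i) (jet2_cst _ _).
Qed.

End AnalyticHolomorphic.

(** * Newton differences of maps close to the identity *)

Section NewtonDifferences.
Local Open Scope complex_scope.
Variables (R : realType) (d : nat).
Implicit Types (F G : Cd R d -> Cd R d) (x y z c v p q : Cd R d) (a mu : R[i]).

Lemma jet2v_cst x a : jet2v (fun=> x) a.
Proof. by move=> j; exact: jet2_cst. Qed.

Lemma jet2vD (z w : R[i] -> Cd R d) a :
  jet2v z a -> jet2v w a -> jet2v (fun s => z s + w s) a.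
Proof. by move=> zJ wJ j; apply: eq_jet2 (jet2D (zJ j) (wJ j)) => s;
  rewrite mxE. Qed.

Lemma jet2vB (z w : R[i] -> Cd R d) a :
  jet2v z a -> jet2v w a -> jet2v (fun s => z s - w s) a.
Proof. by move=> zJ wJ j; apply: eq_jet2 (jet2B (zJ j) (wJ j)) => s;
  rewrite !mxE. Qed.

Lemma jet2vZ (m : R[i] -> R[i]) (z : R[i] -> Cd R d) a :
  jet2 m a -> jet2v z a -> jet2v (fun s => m s *: z s) a.
Proof. by move=> mJ zJ j; apply: eq_jet2 (jet2M mJ (zJ j)) => s;
  rewrite mxE. Qed.

Lemma jet2v_sum (I : Type) (s : seq I) (P : pred I) (f : I -> R[i] ->
  Cd R d) a :
  (forall i, P i -> jet2v (f i) a) ->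
    jet2v (fun t => \sum_(i <- s | P i) f i t) a.
Proof.
move=> fJ j; apply: eq_jet2 (@jet2_sum _ _ s P (fun i t => f i t 0 j) a _).
  by move=> t; rewrite summxE.
by move=> i /fJ.
Qed.

Lemma half_dbl p : 2^-1 *: (p + p) = p.
Proof.
have h : 2^-1 + 2^-1 = 1 :> R[i] by rewrite [RHS]splitr !div1r.
by rewrite scalerDr -scalerDl h scale1r.
Qed.

(** Each coordinate of G(c + s v) - G(c - s v) vanishes at s = 0 and is at most 2 B on |s| <= r /
    |v|; Schwarz is evaluated at s = 1. *)
Lemma symmetric_schwarz G c v (r B : R) : 0 < r -> 0 <= B -> vnorm v <= r ->
  (forall z, vnorm (z - c) <= r -> hol_at G z /\ vnorm (G z) <= B) ->
  vnorm (G (c + v) - G (c - v)) <= 2 * B * (vnorm v / r).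
Proof.
move=> r0 B0 vr HG.
have [v0|v0] := eqVneq v 0.
  by rewrite v0 subr0 addr0 subrr vnorm0 mul0r mulr0.
have {}v0 : 0 < vnorm v.
  by rewrite lt_def vnorm_ge0 andbT; apply: contra_neq v0; exact: vnorm_eq0.
pose rho := r / vnorm v; have rho0 : 0 < rho by rewrite divr_gt0.
have in_disc (s : R[i]) : cabs s <= rho ->
    vnorm (c + s *: v - c) <= r /\ vnorm (c - s *: v - c) <= r.
  rewrite /rho ler_pdivlMr // => sr.
  by rewrite [c + _]addrC [c - _]addrC !addrK vnormN vnormZ.
have vrho : vnorm v / r = cabs 1 / rho by rewrite cabs1 /rho mul1r invf_div.
apply: vnorm_le => [|j]; first by rewrite !mulr_ge0 ?invr_ge0 // ltW.
pose g (s : R[i]) := G (c + s *: v) 0 j - G (c - s *: v) 0 j.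
have -> : (G (c + v) - G (c - v)) 0 j = g 1 by rewrite !mxE /g scale1r.
rewrite vrho; apply: schwarz_zero => //; first by rewrite mulr_ge0.
- move=> s sr; have [h1 h2] := in_disc s sr.
  have lJ : jet2v (fun s : R[i] => s *: v) s.
    by apply: jet2vZ; [exact: jet2_id | exact: jet2v_cst].
  apply: jet2B.
    exact: ((HG _ h1).1 (fun t => c + t *: v) s erefl (jet2vD (jet2v_cst c s) lJ) j).
  exact: ((HG _ h2).1 (fun t => c - t *: v) s erefl (jet2vB (jet2v_cst c s) lJ) j).
- move=> s sr; have [h1 h2] : _ /\ _ := in_disc s ltac:(by rewrite sr).
  apply: le_trans (cabsB _ _) _; rewrite mulr2n mulrDl mul1r.
  by apply: lerD; (apply: le_trans (cabs_coord _ j) _);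
    [case: (HG _ h1)|case: (HG _ h2)].
- by rewrite /g scale0r addr0 subr0 subrr.
- by rewrite cabs1 /rho ler_pdivlMr // mul1r.
Qed.

(* Centering the disc at the midpoint yields the constant B / r; Schwarz at p
   would only give 2 B / r. *)
Lemma hol_lipschitz G p q (r B : R) : 0 < r -> 0 <= B ->
  vnorm (p - q) <= 2 * r ->
  (forall z, vnorm (z - 2^-1 *: (p + q)) <= r ->
    hol_at G z /\ vnorm (G z) <= B) ->
  vnorm (G p - G q) <= B * (vnorm (p - q) / r).
Proof.
move=> r0 B0 pqr HG; pose v : Cd R d := 2^-1 *: (p - q).
have cv2 : cabs (2^-1 : R[i]) = 2^-1 by rewrite cabsV cabs_nat.
have vE : vnorm v = vnorm (p - q) / 2 by rewrite vnormZ cv2 mulrC.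
have := @symmetric_schwarz G (2^-1 *: (p + q)) v r B r0 B0.
have -> : 2^-1 *: (p + q) + v = p.
  by rewrite -scalerDr addrACA subrr addr0 half_dbl.
have -> : 2^-1 *: (p + q) - v = q.
  by rewrite -scalerBr opprB [p + q]addrC addrACA subrr addr0 half_dbl.
move=> H; apply: le_trans (H _ HG) _; first by rewrite vE; lra.
by rewrite vE le_eqVlt; apply/orP; left; apply/eqP; field; rewrite gt_eqF.
Qed.

Definition relaxed mu F z : Cd R d := z + mu *: (F z - z).

Lemma relaxed1 F : relaxed 1 F = F.
Proof. by apply/funext => z; rewrite /relaxed scale1r addrC subrK. Qed.

(** The parameter mu and the base point move together, because the recursion replaces z by F_mu(z),
    which depends on mu even when z does not. A constant mu = 1 gives holomorphy in z, and mu = s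
    gives holomorphy in mu. *)
Lemma newton_diff_jet2v F k (m : R[i] -> R[i]) (z : R[i] -> Cd R d) a :
  jet2 m a -> jet2v z a ->
  (forall j, (j < k)%N -> hol_at F (iter j (relaxed (m a) F) (z a))) ->
  jet2v (fun s => newton_diff (relaxed (m s) F) k (z s)) a.
Proof.
move=> mJ; elim: k z => [|k IHk] z zJ HF //=.
apply: jet2vB; last by apply: IHk => // j jk; apply: HF; exact: ltnW.
apply: (IHk (fun s => relaxed (m s) F (z s))).
  apply: jet2vD => //; apply: jet2vZ => //; apply: jet2vB => //.
  exact: (HF 0%N).
by move=> j jk; rewrite -iterSr; exact: HF.
Qed.

Lemma newton_diff_hol F k z :
  (forall j, (j < k)%N -> hol_at F (iter j F z)) -> hol_at (newton_diff F k) z.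
Proof.
move=> HF w a waz wJ.
have := @newton_diff_jet2v F k (fun=> 1) w a (jet2_cst 1 a) wJ.
by rewrite relaxed1 waz; exact.
Qed.

Lemma iter_near G y z (delta e : R) n : 0 <= e ->
  (forall w, vnorm (w - y) < delta -> vnorm (G w - w) <= e) ->
  vnorm (z - y) + n%:R * e < delta ->
  vnorm (iter n G z - z) <= n%:R * e /\ vnorm (iter n G z - y) < delta.
Proof.
move=> e0 HG; elim: n => [|n IHn] H.
  by rewrite /= subrr vnorm0 mul0r; split=> //; move: H; rewrite mul0r addr0.
have [|IH1 IH2] := IHn.
  by apply: le_lt_trans H; rewrite lerD2l ler_wpM2r // ler_nat.
have IH3 : vnorm (iter n.+1 G z - z) <= n.+1%:R * e.
  apply: le_trans (vnorm_triangle (iter n G z) _ _) _.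
  by rewrite -natr1 mulrDl mul1r addrC; apply: lerD => //; exact: HG.
split => //; apply: le_lt_trans (vnorm_triangle z _ _) _.
by rewrite addrC; apply: le_lt_trans H; rewrite lerD2l.
Qed.

End NewtonDifferences.

(** * Geometric decay of the Newton differences *)

Section NearIdentity.
Local Open Scope complex_scope.
Variables (R : realType) (d : nat) (F : Cd R d ->
  Cd R d) (y : Cd R d) (delta e : R).
Hypothesis e0 : 0 <= e.
Hypothesis holF : forall z, vnorm (z - y) < delta -> hol_at F z.
Hypothesis nearF : forall z, vnorm (z - y) < delta -> vnorm (F z - z) <= e.

Lemma newton_diff_hol_near k z : vnorm (z - y) + k%:R * e < delta ->
  hol_at (newton_diff F k.+1) z.
Proof.
move=> H; apply: newton_diff_hol => j; rewrite ltnS => jk; apply: holF.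
have Hj : vnorm (z - y) + j%:R * e < delta.
  by apply: le_lt_trans H; rewrite lerD2l ler_wpM2r // ler_nat.
by have [] := iter_near e0 nearF Hj.
Qed.

(** Each difference costs a margin eta. The midpoint of z and F z is within e/2 of z, so the ball of
    radius eta - e/2 around it stays within eta of z, where the previous difference is bounded;
    [hol_lipschitz] then gives the factor e / (eta - e/2). *)
Lemma newton_diff_bound (eta : R) k z : e <= eta -> 0 < eta ->
  vnorm (z - y) + k%:R * eta < delta ->
  vnorm (newton_diff F k.+1 z) <= e * (e / (eta - e / 2)) ^+ k.
Proof.
move=> e_eta eta0; have r0 : 0 < eta - e / 2 by move: (e0); lra.
elim: k z => [|k IHk] z Hz.
  rewrite expr0 mulr1; apply: nearF; move: Hz; rewrite mul0r addr0; exact.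
have keta : 0 <= k%:R * eta by rewrite mulr_ge0 // ltW.
have zy : vnorm (z - y) < delta by apply: le_lt_trans Hz;
  rewrite lerDl mulr_ge0 // ltW.
have Fz := nearF zy.
have B0 : 0 <= e * (e / (eta - e / 2)) ^+ k.
  by rewrite mulr_ge0 // exprn_ge0 // divr_ge0 // ltW.
rewrite exprSr mulrA; apply: (@le_trans _ _ (e * (e / (eta - e / 2)) ^+ k *
    (vnorm (F z - z) / (eta - e / 2)))); last first.
  by rewrite ler_wpM2l // ler_wpM2r // invr_ge0 ltW.
apply: (hol_lipschitz (G := newton_diff F k.+1)) => //.
  by apply: le_trans Fz _; lra.
move=> w Hw.
have Hwy : vnorm (w - y) + k%:R * eta < delta.
  have : vnorm (2^-1 *: (F z + z) - z) <= e / 2.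
    have -> : 2^-1 *: (F z + z) - z = 2^-1 *: (F z - z).
      by rewrite -[X in _ - X = _](half_dbl z) -scalerBr opprD addrACA subrr addr0.
    by rewrite vnormZ cabsV cabs_nat mulrC ler_wpM2r // invr_ge0.
  have := vnorm_triangle (2^-1 *: (F z + z)) w z.
  have := vnorm_triangle z w y; move: Hz; rewrite -natr1 mulrDl mul1r; lra.
split; last exact: IHk.
apply: newton_diff_hol_near; apply: le_lt_trans Hwy.
by rewrite lerD2l ler_wpM2l.
Qed.

End NearIdentity.

(** * Binomial functions *)

Section NewtonBinomial.
Local Open Scope complex_scope.
Variable K : numFieldType.
Implicit Types (s : K) (n k i : nat).

(** The field is left general: sharp bounds on [0, 1] are proved over the reals, whereas growth and
    holomorphy are needed over the complex numbers. *)
Fixpoint nbin s k : K :=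
  if k is k'.+1 then nbin s k' * (s - k'%:R) / k'.+1%:R else 1.

Fixpoint dnbin s k : K :=
  if k is k'.+1 then (dnbin s k' * (s - k'%:R) + nbin s k') / k'.+1%:R else 0.

Definition log_coef k : K := (-1) ^+ k.-1 / k%:R.

Lemma nbin_nat n k : nbin n%:R k = 'C(n, k)%:R.
Proof.
elim: k => [|k /= ->]; first by rewrite bin0.
have k0 : k.+1%:R != 0 :> K by rewrite pnatr_eq0.
apply: (mulIf k0); rewrite divfK // -natrM mulnC mul_bin_left natrM mulrC.
have [kn|nk] := leqP k n; first by rewrite natrB.
by rewrite bin_small // !mulr0.
Qed.

(* The derivation d/ds is log(1 + Delta) on polynomials in s, and Delta lowers
   the index of [nbin] by one. *)
Lemma dnbin_log s n :
  dnbin s n = \sum_(1 <= k < n.+1) log_coef k * nbin s (n - k).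
Proof.
elim: n => [|n /= ->]; first by rewrite big_geq.
have n0 : n.+1%:R != 0 :> K by rewrite pnatr_eq0.
apply: (mulIf n0); rewrite divfK //.
(* Write s - n = (s - (n - k)) - k: the first part raises the index of [nbin], and -k cancels the
   denominator of [log_coef]. The companion [E2] splits n + 1 as (n + 1 - k) + k, and the remaining
   alternating sums agree after a shift. *)
have E k : (1 <= k < n.+1)%N ->
    log_coef k * nbin s (n - k) * (s - n%:R) =
    log_coef k * nbin s (n.+1 - k) * (n.+1 - k)%:R + (-1) ^+ k * nbin s (n - k).
  move=> /andP[k0 kn]; rewrite subSn //= ?divfK ?pnatr_eq0 //.
  rewrite natrB // -!mulrA; case: k k0 kn => // k _ kn.
  rewrite /log_coef /= exprS; field; rewrite ?pnatr_eq0 //.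
  by rewrite !nat1r !pnatr_eq0.
have E2 k : (1 <= k < n.+2)%N -> log_coef k * nbin s (n.+1 - k) * n.+1%:R =
    log_coef k * nbin s (n.+1 - k) * (n.+1 - k)%:R + (-1) ^+ k.-1 * nbin s (n.+1 - k).
  move=> /andP[k0 kn]; rewrite natrB //; case: k k0 kn => // k _ kn.
  by rewrite /log_coef /=; field; rewrite !(nat1r, natr1) ?pnatr_eq0.
rewrite mulr_suml (eq_big_nat _ _ E) big_split /=.
rewrite [RHS]mulr_suml (eq_big_nat _ _ E2) big_split /= -addrA; congr (_ + _).
  by rewrite [RHS]big_nat_recr //= subnn mulr0 addr0.
rewrite [RHS]big_nat_recl // expr0 mul1r subn1 addrC; congr (_ + _).
Qed.

End NewtonBinomial.

Section NewtonBinomialBounds.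
Local Open Scope complex_scope.
Variable R : realType.
Implicit Types (t u : R) (s : R[i]).

Lemma nbin_real t k : nbin (t%:C) k = (nbin t k)%:C.
Proof.
elim: k => [|k /= ->]; first by rewrite /= rmorph1.
by rewrite !rmorphM rmorphB fmorphV !rmorph_nat.
Qed.

Lemma dnbin_real t k : dnbin (t%:C) k = (dnbin t k)%:C.
Proof.
elim: k => [|k /= ->]; first by rewrite /= rmorph0.
by rewrite nbin_real rmorphM rmorphD rmorphM rmorphB fmorphV !rmorph_nat.
Qed.

(* Here P = \prod_(1 <= j < k) (1 - t / j) and Q = t P'. *)
Lemma nbin_unit_form t k : 0 <= t <= 1 -> exists P Q : R,
  [/\ 0 <= P <= 1, P - 1 <= Q <= 0,
      nbin t k.+1 = (-1) ^+ k * (t * P) / k.+1%:R &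
      dnbin t k.+1 = (-1) ^+ k * (P + Q) / k.+1%:R].
Proof.
move=> /andP[t0 t1]; elim: k => [|k [P [Q [/andP[P0 P1] /andP[Q1 Q0] HP HQ]]]].
  exists 1, 0; split; rewrite ?ler01 ?subrr ?lexx //=.
    by rewrite subr0 expr0 !mul1r mulr1.
  by rewrite mul0r add0r expr0 addr0 mulr1.
have k1 : 1 <= k.+1%:R :> R by rewrite ler1n.
have a0 : k.+1%:R != 0 :> R by rewrite pnatr_eq0.
have b0 : k.+2%:R != 0 :> R by rewrite pnatr_eq0.
have tk : 0 <= t / k.+1%:R <= 1.
  by rewrite divr_ge0 //= ler_pdivrMr ?ltr0n // mul1r (le_trans t1).
exists (P * (1 - t / k.+1%:R)), (Q * (1 - t / k.+1%:R) - t / k.+1%:R * P).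
move: tk; set w := t / k.+1%:R => /andP[w0 w1]; split.
- by apply/andP; split; nra.
- by apply/andP; split; nra.
- have -> : nbin t k.+2 = nbin t k.+1 * (t - k.+1%:R) / k.+2%:R by [].
  rewrite HP exprS /w; move: (k.+1%:R : R) (k.+2%:R : R) a0 b0 => a b a0 b0.
  by field; rewrite ?a0 ?b0.
- have -> : dnbin t k.+2 = (dnbin t k.+1 * (t - k.+1%:R) + nbin t k.+1) / k.+2%:R by [].
  rewrite HP HQ exprS /w; move: (k.+1%:R : R) (k.+2%:R : R) a0 b0 => a b a0 b0.
  by field; rewrite ?a0 ?b0.
Qed.

Lemma nbin_unit_le t k : 0 <= t <= 1 -> `|nbin t k.+1| <= k.+1%:R^-1.
Proof.
move=> t01; have [P [Q [/andP[P0 P1] _ -> _]]] := nbin_unit_form k t01.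
move/andP: t01 => [t0 t1].
rewrite normrM normfV (ger0_norm (ler0n _ _)) ler_piMl // normrMsign.
by rewrite ger0_norm ?mulr_ge0 // mulr_ile1.
Qed.

Lemma nbin_unit_le1 t k : 0 <= t <= 1 -> `|nbin t k| <= 1.
Proof.
move=> t01; case: k => [|k]; first by rewrite normr1.
by apply: le_trans (nbin_unit_le _ t01) _; rewrite invf_le1 ?ltr0n // ler1n.
Qed.

(** P + Q lies between 2 P - 1 and P, hence in [-1, 1]. *)
Lemma dnbin_unit_le t k : 0 <= t <= 1 -> `|dnbin t k.+1| <= k.+1%:R^-1.
Proof.
move=> t01; have [P [Q [/andP[P0 P1] /andP[Q0 Q1] _ ->]]] := nbin_unit_form k t01.
rewrite normrM normfV (ger0_norm (ler0n _ _)) ler_piMl // normrMsign.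
by rewrite ler_norml; lra.
Qed.

(** An explicit quadratic remainder, from which the derivative of the interpolating curve is read
    off. In the recursion the factor |u - k| is absorbed by the denominator k + 1. *)
Lemma nbin_taylor t u k : 0 <= t <= 1 -> 0 <= u <= 1 ->
  `|nbin u k - nbin t k - (u - t) * dnbin t k| <= k%:R * (u - t) ^+ 2.
Proof.
move=> t01 u01; elim: k => [|k IHk];
  first by rewrite /= subrr mulr0 subr0 normr0 mul0r.
have dle : `|dnbin t k| <= 1.
  case: {IHk} k => [|k]; first by rewrite normr0.
  by apply: le_trans (dnbin_unit_le _ t01) _; rewrite invf_le1 ?ltr0n // ler1n.
have uk : `|u - k%:R| <= k.+1%:R.
  have k0 : 0 <= k%:R :> R by [].
  by move/andP: u01 => [u0 u1]; rewrite -natr1 ler_norml; lra.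
set D := nbin u k - _ - _ in IHk.
have -> : nbin u k.+1 - nbin t k.+1 - (u - t) * dnbin t k.+1 =
    (D * (u - k%:R) + (u - t) ^+ 2 * dnbin t k) / k.+1%:R.
  by rewrite /D /=; field; rewrite !(natr1, nat1r) ?pnatr_eq0.
rewrite normrM normfV (ger0_norm (ler0n _ _)) ler_pdivrMr ?ltr0n //.
apply: le_trans (ler_normD _ _) _; rewrite (normrM D) (normrM ((u - t) ^+ 2)).
have u2 := sqr_ge0 (u - t); rewrite (ger0_norm u2).
have k1 : 1 <= k.+1%:R :> R by rewrite ler1n.
apply: (@le_trans _ _ (k%:R * (u - t) ^+ 2 * k.+1%:R + (u - t) ^+ 2 * 1)).
  by apply: lerD; [exact: ler_pM | rewrite ler_wpM2l].
have : 0 <= k%:R * (u - t) ^+ 2 by rewrite mulr_ge0.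
rewrite -natr1; move: ((u - t) ^+ 2) (k%:R : R) => w a; lra.
Qed.

Lemma nbin_growth s (m k : nat) : (k <= m)%N ->
  cabs (nbin s k) <= (cabs s + m%:R) ^+ k.
Proof.
elim: k => [|k IHk] km /=; first by rewrite cabs1.
rewrite exprSr !cabsM -mulrA; apply: ler_pM; rewrite ?mulr_ge0 ?cabs_ge0 //.
  exact: IHk (ltnW km).
rewrite cabsV cabs_nat ler_pdivrMr ?ltr0n //.
apply: (@le_trans _ _ (cabs s + m%:R)).
  apply: le_trans (cabsB _ _) _; rewrite cabs_nat lerD2l ler_nat; exact: ltnW.
by rewrite ler_peMr ?addr_ge0 ?cabs_ge0 // ler1n.
Qed.

Lemma nbin_jet2 k s : jet2 (fun s => nbin s k) s.
Proof.
elim: k => [|k IHk] /=; first exact: jet2_cst.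
apply: jet2M (jet2_cst _ _); apply: jet2M => //.
exact: jet2B (jet2_id _) (jet2_cst _ _).
Qed.

Lemma cabs_log_coef k : cabs (log_coef R[i] k) = k%:R^-1.
Proof. by rewrite /log_coef cabsM cabsV cabs_nat cabsX cabsN cabs1 expr1n mul1r. Qed.

(** Bounding 1/k by 1/2 for k >= 2 gives 1 + 1/4; the term 3^-m / 4 that strengthens the induction
    is the corresponding geometric tail. *)
Lemma sum_inv_geometric3 m :
  \sum_(1 <= k < m.+2) k%:R^-1 * 3^-1 ^+ k.-1 <= 5 / 4 :> R.
Proof.
suff : \sum_(1 <= k < m.+2) k%:R^-1 * 3^-1 ^+ k.-1
  <= 5 / 4 - 3^-1 ^+ m / 4 :> R.
  have : 0 <= 3^-1 ^+ m :> R by rewrite exprn_ge0 // invr_ge0.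
  lra.
elim: m => [|m IHm]; first by rewrite big_nat1 /= !expr0 mulr1 invr1; lra.
rewrite big_nat_recr //=.
have q0 : 0 <= 3^-1 ^+ m :> R by rewrite exprn_ge0 // invr_ge0.
have : m.+2%:R^-1 <= 2^-1 :> R by rewrite lef_pV2 ?posrE ?ltr0n // ler_nat.
move: IHm; rewrite exprS; set S := \sum_(_ <= _ < _) _;
  set q := 3^-1 ^+ m in q0 *.
set z := m.+2%:R^-1; clearbody S q z; nra.
Qed.

End NewtonBinomialBounds.

(** * The defect of the Newton interpolation *)

Arguments nbin : simpl never.
Arguments dnbin : simpl never.

Section InterpolationDefect.
Local Open Scope complex_scope.
Variables (R : realType) (d : nat).
Implicit Types (F : Cd R d -> Cd R d) (y z : Cd R d) (s a mu :
  R[i]) (e delta t : R).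

Definition interp_curve F y m s : Cd R d :=
  \sum_(0 <= k < m.+1) nbin s k *: newton_diff F k y.

Definition interp_velocity F y m s : Cd R d :=
  \sum_(0 <= k < m.+1) dnbin s k *: newton_diff F k y.

Definition defect F y m s : Cd R d :=
  interp_velocity F y m s - interp_field F m (interp_curve F y m s).

Lemma newton_diffSr F k y :
  newton_diff F k (F y) = newton_diff F k.+1 y + newton_diff F k y.
Proof. by rewrite /= subrK. Qed.

(** The shift along the orbit is 1 + Delta, so its j-th power expands binomially; the induction is
    Pascal's rule. The terms with i > j vanish, so every truncation beyond j gives the same
    value. *)
Lemma newton_formula F y N j k : (j < N)%N ->
  \sum_(0 <= i < N) nbin (j%:R : R[i]) i *: newton_diff F (k + i) y =
  newton_diff F k (iter j F y).
Proof.
elim: j N y => [|j IHj] [|N] y // jN.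
  rewrite big_nat_recl // big_nat big1; last first.
    by move=> i _; rewrite nbin_nat bin0n scale0r.
  by rewrite addr0 addn0 scale1r.
rewrite iterSr -(IHj N.+1) ?(ltnW jN) //.
under [RHS]eq_bigr do rewrite newton_diffSr scalerDr.
rewrite big_split /= [X in _ = X + _]big_nat_recr //= nbin_nat bin_small //.
rewrite scale0r addr0 big_nat_recl // [X in _ = _ + X]big_nat_recl //.
rewrite [RHS]addrCA; congr (_ + _); rewrite -big_split /=.
apply: eq_big_nat => i _; rewrite !addnS -scalerDl; congr (_ *: _).
by rewrite !nbin_nat binS natrD addrC.
Qed.

Lemma interp_curve0 F y m : interp_curve F y m 0 = y.
Proof. by have := @newton_formula F y m.+1 0 0 isT. Qed.

Lemma interp_curve_nat F y m j : (j <= m)%N ->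
  interp_curve F y m j%:R = iter j F y.
Proof. by move=> jm; have := @newton_formula F y m.+1 j 0 jm. Qed.

(** By [dnbin_log], gamma' is log(1 + Delta) applied to the interpolation, cut to the triangle k + i
    <= m. This is the form in which it can be compared with X_m(gamma). *)
Lemma interp_velocityE F y m s : interp_velocity F y m s =
  \sum_(1 <= k < m.+1) \sum_(0 <= i < m.+1 - k)
    (log_coef _ k * nbin s i) *: newton_diff F (k + i) y.
Proof.
rewrite /interp_velocity.
have E n : (0 <= n < m.+1)%N -> dnbin s n *: newton_diff F n y =
    \sum_(1 <= k < m.+1 | (k < n.+1)%N) (log_coef _ k * nbin s (n - k)) *: newton_diff F n y.
  by move=> /andP[_ nm]; rewrite dnbin_log scaler_suml (big_nat_widen 1 n.+1 m.+1).
rewrite (eq_big_nat _ _ E) (exchange_big_dep_nat xpredT) //=.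
apply: eq_big_nat => k /andP[k1 km].
rewrite -(big_nat_widenl k 0 m.+1 xpredT) // -{1}[k]add0n big_addn.
by apply: eq_bigr => i _; rewrite addnK addnC.
Qed.

(** Serves X_m, gamma - y and gamma' at once: in each, the k-th coefficient is at most 1/k in
    modulus. *)
Lemma weighted_sum_bound (c : nat -> R[i]) (D : nat -> Cd R d) m e : 0 <= e ->
  (forall k, (k <= m)%N -> cabs (c k.+1) <= k.+1%:R^-1) ->
  (forall k, (k <= m)%N -> vnorm (D k.+1) <= e * 3^-1 ^+ k) ->
  vnorm (\sum_(1 <= k < m.+2) c k *: D k) <= 5 / 4 * e.
Proof.
move=> e0 Hc HD; apply: le_trans (vnorm_sum _ _ _) _.
apply: (@le_trans _ _ (\sum_(1 <= k < m.+2) (k%:R^-1 * 3^-1 ^+ k.-1) * e)).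
  apply: ler_sum_nat => -[|k] // /andP[_ km];
    rewrite vnormZ -mulrA [_ ^+ _ * e]mulrC.
  by apply: ler_pM; rewrite ?cabs_ge0 ?vnorm_ge0 ?Hc ?HD.
by rewrite -mulr_suml ler_wpM2r // sum_inv_geometric3.
Qed.

Section Bounds.
Variables (F : Cd R d -> Cd R d) (y : Cd R d) (delta e : R).
Hypothesis e0 : 0 <= e.
Hypothesis holF : forall z, vnorm (z - y) < delta -> hol_at F z.
Hypothesis nearF : forall z, vnorm (z - y) < delta -> vnorm (F z - z) <= e.

(** The margin 2 delta / 3 between the two balls is shared among m + 1 differences. The constant 6
    makes each share eta at least 4 e, so the factor e / (eta - e/2) is at most 1/3. *)
Lemma newton_diff_third m k z : 6 * m.+1%:R * e <= delta -> 0 < delta ->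
  (k <= m.+1)%N -> vnorm (z - y) < delta / 3 ->
  vnorm (newton_diff F k.+1 z) <= e * 3^-1 ^+ k.
Proof.
move=> me delta0 km zy; set M : R := m.+1%:R in me.
have M1 : 1 <= M by rewrite ler1n.
have M0 : 0 < M by exact: lt_le_trans M1.
pose eta := 2 * delta / 3 / M.
have etaM : M * eta = 2 * delta / 3 by rewrite /eta mulrC divfK // gt_eqF.
have eta0 : 0 < eta by rewrite !divr_gt0 // mulr_gt0.
have e_eta : 4 * e <= eta.
  rewrite -(ler_pM2l M0) etaM; move: me; rewrite -mulrA; lra.
have kM : k%:R * eta <= 2 * delta / 3
  by rewrite -etaM ler_wpM2r ?ler_nat // ltW.
apply: le_trans (newton_diff_bound e0 holF nearF (eta := eta) _ eta0 _) _.
- by move: (e0); lra.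
- by lra.
rewrite ler_wpM2l //.
have D0 : 0 < eta - e / 2 by move: (e0); lra.
rewrite lerXn2r ?nnegrE ?divr_ge0 ?invr_ge0 ?(ltW D0) //.
by rewrite ler_pdivrMr //; move: (e0); lra.
Qed.

Lemma interp_bounds m : 6 * m.+1%:R * e <= delta -> 0 < delta ->
  [/\ forall z, vnorm (z - y) < delta / 3 ->
    vnorm (interp_field F m.+2 z) <= 5 / 4 * e,
      forall t, 0 <= t <= 1 -> vnorm (interp_curve F y m.+2 t%:C - y)
        <= 5 / 4 * e &
      forall t, 0 <= t <= 1 -> vnorm (interp_velocity F y m.+2 t%:C)
        <= 5 / 4 * e].
Proof.
move=> me delta0; have HD := newton_diff_third me delta0.
have yy : vnorm (y - y) < delta / 3 by rewrite subrr vnorm0 divr_gt0.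
split=> [z zy|t t01|t t01].
- apply: weighted_sum_bound => // k km; last exact: HD.
  by rewrite -/(log_coef R[i] k.+1) cabs_log_coef.
- rewrite /interp_curve big_nat_recl //= scale1r [y + _]addrC addrK.
  rewrite -(big_add1 _ _ 0 m.+3 xpredT (fun k => nbin t%:C k *: newton_diff F k y)).
  apply: weighted_sum_bound => // k km; last exact: HD.
  by rewrite nbin_real cabs_real nbin_unit_le.
- rewrite /interp_velocity big_nat_recl //= scale0r add0r.
  rewrite -(big_add1 _ _ 0 m.+3 xpredT (fun k => dnbin t%:C k *: newton_diff F k y)).
  apply: weighted_sum_bound => // k km; last exact: HD.
  by rewrite dnbin_real cabs_real dnbin_unit_le.
Qed.

End Bounds.

End InterpolationDefect.

(** * The defect for small displacements *)

Section SmallDefect.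
Local Open Scope complex_scope.
Variables (R : realType) (d : nat).
Implicit Types (F : Cd R d -> Cd R d) (y z : Cd R d) (s a mu :
  R[i]) (e delta t : R).

Lemma interp_field_jet2v F m (mu : R[i] -> R[i]) (z : R[i] -> Cd R d) a :
  jet2 mu a -> jet2v z a ->
  (forall j, (j < m)%N -> hol_at F (iter j (relaxed (mu a) F) (z a))) ->
  jet2v (fun s => interp_field (relaxed (mu s) F) m (z s)) a.
Proof.
move=> muJ zJ HF; pose f k s := log_coef _ k *: newton_diff (relaxed (mu s) F) k (z s).
(* The range is repeated as a predicate so that [jet2v_sum] supplies the bound k <= m, on which
   holomorphy along the orbit depends. *)
have E s : interp_field (relaxed (mu s) F) m (z s) =
    \sum_(1 <= k < m.+1 | (k <= m)%N) f k s.
  rewrite -(big_nat_widen 1 m.+1 m.+1 xpredT (fun k => f k s)) //.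
suff H : jet2v (fun s => \sum_(1 <= k < m.+1 | (k <= m)%N) f k s) a.
  by move=> j; apply: eq_jet2 (H j) => s; rewrite E.
apply: jet2v_sum => k km; apply: jet2vZ; first exact: jet2_cst.
by apply: newton_diff_jet2v => // j jk; apply: HF; exact: leq_trans km.
Qed.

Lemma fixed_field_jet2v F m (z : R[i] -> Cd R d) a : jet2v z a ->
  (forall j, (j < m)%N -> hol_at F (iter j F (z a))) ->
  jet2v (fun s => interp_field F m (z s)) a.
Proof.
move=> zJ HF; have := @interp_field_jet2v F m (fun=> 1) z a (jet2_cst 1 a) zJ.
by rewrite relaxed1; exact.
Qed.

Lemma prod_shift_near (n i : nat) : (i < n)%N -> exists2 c : R, 0 < c &
  forall z : R[i], cabs (z - i%:R) < 2^-1 ->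
    c * cabs (z - i%:R) <= cabs (\prod_(j < n) (z - j%:R)).
Proof.
move=> i_n; exists (\prod_(j < n | j != Ordinal i_n) 2^-1).
  by apply: prodr_gt0 => j _; rewrite invr_gt0.
move=> z zi; rewrite [X in _ <= cabs X](bigD1 (Ordinal i_n)) //= cabsM
  [leRHS]mulrC ler_wpM2r ?cabs_ge0 //.
rewrite (big_morph _ (@cabsM R) (cabs1 R)); apply: ler_prod => j ji.
rewrite invr_ge0 /= ler0n /=.
have ij : 1 <= cabs (i%:R - j%:R : R[i]).
  have {}ji : (nat_of_ord j != i)%N by [].
  have [lt|lt|E] := ltngtP i j; last by rewrite E eqxx in ji.
    by rewrite cabsC -natrB ?cabs_nat ?ler1n ?subn_gt0 // ltnW.
  by rewrite -natrB ?cabs_nat ?ler1n ?subn_gt0 // ltnW.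
have := cabsD (i%:R - z) (z - j%:R); rewrite addrA subrK (cabsC i%:R z).
by lra.
Qed.

(** [C] and [E0] depend on m and delta only, so they are the same for all the maps F_mu, to which
    this is applied with e = |mu| eps. *)
Lemma defect_small m delta : 0 < delta ->
  exists (C E0 : R), [/\ 0 <= C, 0 < E0 &
  forall F y e t, 0 < e <= E0 ->
    (forall z, vnorm (z - y) < delta -> hol_at F z) ->
    (forall z, vnorm (z - y) < delta -> vnorm (F z - z) <= e) ->
    0 <= t <= 1 -> vnorm (defect F y m.+1 t%:C) <= C * e ^+ m.+2].
Proof.
move=> delta0; pose n := m.+1; pose N : R := n%:R.
have N1 : 1 <= N by rewrite ler1n.
have N0 : 0 < N by exact: lt_le_trans N1.
(* Differences up to order 2 m + 1 occur at y, so 2 m margins eta must fit into delta; at points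
   within delta/3 of y, at most m margins are needed. *)
pose eta := delta / (3 * N).
have eta0 : 0 < eta by rewrite divr_gt0 // mulr_gt0.
have Neta : N * eta = delta / 3.
  by rewrite /eta; field; rewrite gt_eqF.
clearbody eta.
have etad : eta <= delta / 3 by rewrite -Neta ler_peMl // ltW.
pose C1 := (N * N + N) * N ^+ n * (16 * N / eta) ^+ n.
pose C2 := N * N * (2 / eta) ^+ n.
have C10 : 0 <= C1.
  by rewrite !mulr_ge0 ?exprn_ge0 ?divr_ge0 ?addr_ge0 ?mulr_ge0 ?(ltW N0) ?(ltW eta0).
have C20 : 0 <= C2 by rewrite !mulr_ge0 ?exprn_ge0 ?divr_ge0 ?(ltW N0) ?(ltW eta0).
(* The threshold on e is what makes T >= 2 N below, so that the circle |s| = T stays at distance at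
   least T/2 from every node. *)
exists (C1 + C2), (eta / (16 * N ^+ 2)); split.
- exact: addr_ge0.
- by rewrite divr_gt0 // mulr_gt0 // exprn_gt0.
move=> F y e t /andP[e0 eE0] holF nearF t01.
have e0' := ltW e0.
have NNe : 16 * N ^+ 2 * e <= eta.
  by move: eE0; rewrite ler_pdivlMr ?mulr_gt0 ?exprn_gt0 // mulrC.
have NN : 1 <= N ^+ 2 by rewrite exprn_ege1.
have e_eta : 16 * e <= eta.
  apply: le_trans NNe; rewrite ler_wpM2r //; lra.
pose p := 2 * e / eta.
have p0 : 0 <= p by rewrite divr_ge0 ?mulr_ge0 // ltW.
have p1 : p <= 1 by rewrite ler_pdivrMr // mul1r; lra.
have ratio : 0 <= e / (eta - e / 2) <= p.
  have D0 : 0 < eta - e / 2 by lra.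
  apply/andP; split; first by rewrite divr_ge0 // ltW.
  rewrite ler_pdivrMr // /p mulrAC ler_pdivlMr //; nra.
have HD z k : vnorm (z - y) + k%:R * eta < delta ->
  vnorm (newton_diff F k.+1 z) <= e * p ^+ k.
  move=> H; apply: le_trans (newton_diff_bound e0' holF nearF _ eta0 H) _;
    first lra.
  by case/andP: ratio => r0 r1; rewrite ler_wpM2l // lerXn2r // nnegrE.
have nat_eta k : (k <= m)%N -> k%:R * eta <= delta / 3 - eta.
  move=> km; have : k.+1%:R * eta <= N * eta
    by rewrite ler_wpM2r ?ler_nat // ltW.
  by rewrite -natr1 mulrDl mul1r Neta; lra.
have HDy k : (k <= m + m)%N -> vnorm (newton_diff F k.+1 y) <= e * p ^+ k.
  move=> km; apply: HD; rewrite subrr vnorm0 add0r.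
  apply: (@le_lt_trans _ _ ((m + m)%:R * eta));
    first by rewrite ler_wpM2r ?ler_nat // ltW.
  have := nat_eta m (leqnn m); rewrite natrD mulrDl; lra.
have HDz k z : (k <= m)%N -> vnorm (z - y) < delta / 3 ->
  vnorm (newton_diff F k.+1 z) <= e * p ^+ k.
  by move=> /nat_eta km zy; apply: HD; lra.
(* [T] is of order 1/e, with 2 T p = 1/(2 N): the growth (2 T)^k of [nbin] is compensated by the
   decay p^k of the differences. The curve then stays within N * 2 T e = eta/4 of y. *)
have [T TE] : exists T : R, T = eta / (8 * N * e) by eexists.
have Ne0 : 0 < 8 * N * e by rewrite !mulr_gt0.
have T0 : 0 < T by rewrite TE divr_gt0.
have T2N : 2 * N <= T.
  by rewrite TE ler_pdivlMr //; move: NNe; rewrite expr2; lra.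
have TT0 : 0 <= 2 * T by rewrite mulr_ge0 // ltW.
have Tp0 : 0 <= 2 * T * p by exact: mulr_ge0.
have Tp : 2 * T * p <= 1.
  have -> : 2 * T * p = 2^-1 / N.
    by rewrite TE /p; field; rewrite !gt_eqF.
  by rewrite ler_pdivrMr // mul1r; lra.
have NTe : N * (2 * T * e) = eta / 4.
  by rewrite TE; field; rewrite !gt_eqF.
have near_iter z j : (j < n)%N -> vnorm (z - y) < delta / 3 ->
  hol_at F (iter j F z).
  move=> jn zy; apply: holF.
  have Hj : vnorm (z - y) + j%:R * e < delta.
    have : j%:R * e <= N * e by rewrite ler_wpM2r // ler_nat ltnW.
    have : N * e <= N * eta by rewrite ler_wpM2l ?(ltW N0) //; lra.
    rewrite Neta; lra.
  by have [] := iter_near e0' nearF Hj.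
have nbinT s k : cabs s <= T -> (k <= n)%N -> cabs (nbin s k) <= (2 * T) ^+ k.
  move=> sT kn; apply: le_trans (nbin_growth s kn) _.
  rewrite lerXn2r ?nnegrE ?addr_ge0 ?cabs_ge0 ?mulr_ge0 ?(ltW T0) // -/N; lra.
have curve_near s : cabs s <= T -> vnorm (interp_curve F y n s - y) < delta / 3.
  move=> sT; apply: (@le_lt_trans _ _ (eta / 4)); last by lra.
  rewrite /interp_curve big_nat_recl //= scale1r [y + _]addrC addrK.
  apply: le_trans (vnorm_sum _ _ _) _.
  apply: (@le_trans _ _ (\sum_(0 <= i < n) 2 * T * e)); last first.
    by rewrite sumr_const_nat subn0 -[_ *+ n]mulr_natl NTe.
  apply: ler_sum_nat => i /andP[_ i_n]; rewrite vnormZ.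
  apply: le_trans (ler_pM (cabs_ge0 _) (vnorm_ge0 _) (nbinT _ _ sT i_n) (HDy i _)) _.
    by rewrite (leq_trans _ (leq_addr _ _)).
  have -> : (2 * T) ^+ i.+1 * (e * p ^+ i) = 2 * T * e * (2 * T * p) ^+ i.
    by rewrite [(2 * T * p) ^+ i]exprMn exprS;
      move: ((2 * T) ^+ i) (p ^+ i) => u v; ring.
  by rewrite ler_piMr ?exprn_ile1 // mulr_ge0.
have field_near z : vnorm (z - y) < delta / 3 ->
  vnorm (interp_field F n z) <= N * e.
  move=> zy; apply: le_trans (vnorm_sum _ _ _) _.
  apply: (@le_trans _ _ (\sum_(1 <= i < n.+1) e)); last first.
    by rewrite sumr_const_nat subSS subn0 mulr_natl.
  apply: ler_sum_nat => -[|k] // /andP[_ kn]; rewrite vnormZ cabs_log_coef.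
  rewrite -[leRHS]mul1r; apply: ler_pM; rewrite ?invr_ge0 ?vnorm_ge0 //.
    by rewrite invf_le1 ?ltr0n // ler1n.
  by apply: le_trans (HDz k z kn zy) _; rewrite ler_piMr // exprn_ile1.
(* The triangle k + i <= n of the velocity is completed to 1 <= k <= n, 0 <= i < n. With the full
   range of i, [newton_formula] is exact at s = j < n, so the double sum is X_n(F^j(y)) there and G
   vanishes. *)
pose G s := \sum_(0 <= i < n) \sum_(1
  <= k < n.+1) (log_coef _ k * nbin s i) *: newton_diff F (k + i) y
  - interp_field F n (interp_curve F y n s).
have G_nat j : (j < n)%N -> G j%:R = 0.
  move=> jn; apply/eqP; rewrite subr_eq0; apply/eqP.
  rewrite interp_curve_nat ?(ltnW jn) // exchange_big_nat /=.
  apply: eq_big_nat => k _; rewrite -(@newton_formula _ _ F y n j k jn) scaler_sumr.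
  by apply: eq_bigr => i _; rewrite scalerA.
have curveJ s : jet2v (interp_curve F y n) s.
  apply: jet2v_sum => k _; apply: jet2vZ (jet2v_cst _ _); exact: nbin_jet2.
have GJ s : cabs s <= T -> jet2v G s.
  move=> sT; apply: jet2vB.
    apply: jet2v_sum => i _; apply: jet2v_sum => k _;
      apply: jet2vZ (jet2v_cst _ _).
    apply: jet2M (jet2_cst _ _) _; exact: nbin_jet2.
  by apply: fixed_field_jet2v => // j jn; apply: near_iter => //;
    exact: curve_near.
have GT s : cabs s <= T -> vnorm (G s) <= (N * N + N) * e.
  move=> sT; apply: le_trans (vnormB _ _) _; rewrite mulrDl; apply: lerD;
    last first.
    by apply: field_near; exact: curve_near.
  apply: le_trans (vnorm_sum _ _ _) _.
  apply: (@le_trans _ _ (\sum_(0 <= i < n) N * e)); last first.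
    by rewrite sumr_const_nat subn0 -[_ *+ n]mulr_natl mulrA.
  apply: ler_sum_nat => i /andP[_ i_n]; apply: le_trans (vnorm_sum _ _ _) _.
  apply: (@le_trans _ _ (\sum_(1 <= k < n.+1) e)); last first.
    by rewrite sumr_const_nat subSS subn0 mulr_natl.
  apply: ler_sum_nat => -[|k] // /andP[_ kn];
    rewrite vnormZ cabsM cabs_log_coef.
  have -> : e = 1 * (2 * T) ^+ i * (e * (2 * T) ^- i).
    by rewrite mul1r mulrCA divff ?mulr1 // expf_neq0 // mulf_neq0 // ?pnatr_eq0 // gt_eqF.
  apply: ler_pM; rewrite ?mulr_ge0 ?invr_ge0 ?cabs_ge0 ?vnorm_ge0 //.
    apply: ler_pM; rewrite ?invr_ge0 ?cabs_ge0 //;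
      last exact: nbinT _ (ltnW i_n).
    by rewrite invf_le1 ?ltr0n // ler1n.
  rewrite addSn; apply: le_trans (HDy _ _) _; first exact: leq_add.
  rewrite ler_wpM2l // exprD -exprVn -[leRHS]mul1r; apply: ler_pM;
    rewrite ?exprn_ge0 //.
    exact: exprn_ile1.
  rewrite lerXn2r ?nnegrE ?invr_ge0 //.
  by rewrite -[leRHS]mul1r ler_pdivlMr ?mulr_gt0 // mulrC.
(* The added corner contains only differences of order k + i >= n + 1, each at most e p^n, hence of
   size O(e^(n+1)). *)
have DE : defect F y m.+1 t%:C = G t%:C - (\sum_(1 <= k < n.+1) \sum_(n.+1 - k
  <= i < n)
   (log_coef _ k * nbin t%:C i) *: newton_diff F (k + i) y).
  rewrite /defect interp_velocityE /G addrAC; congr (_ - _).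
  rewrite exchange_big_nat /= -sumrB; apply: eq_big_nat => k /andP[k1 kn].
  rewrite [X in _ = X - _](@big_cat_nat _ _ _ (n.+1 - k)) //=;
    last by rewrite leq_subLR -addn1 addnC leq_add.
  by rewrite addrK.
clearbody G.
pose Q s := \prod_(j < n) (s - j%:R : R[i]).
have QJ s : jet2 Q s.
  by apply: jet2_prod => j _; exact: jet2B (jet2_id _) (jet2_cst _ _).
have T2 : 0 < T / 2 by rewrite divr_gt0.
have QT s : cabs s = T -> (T / 2) ^+ n <= cabs (Q s).
  move=> sT; rewrite /Q (big_morph _ (@cabsM R) (cabs1 R)) -[n in _ ^+ n]card_ord -prodr_const.
  apply: ler_prod => j _; rewrite (ltW T2) /=.
  have := cabsB (s - j%:R) (- j%:R); rewrite opprK subrK sT cabsN cabs_nat.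
  have : j%:R <= N by rewrite ler_nat ltnW.
  by lra.
pose B := (N * N + N) * e / (T / 2) ^+ n.
have B0 : 0 <= B.
  by rewrite divr_ge0 ?exprn_ge0 ?(ltW T2) // mulr_ge0 ?addr_ge0 ?mulr_ge0 ?(ltW N0).
have tT : cabs t%:C <= T.
  move/andP: t01 => [t0 t1]; rewrite cabs_real ger0_norm //; lra.
have Gt : vnorm (G t%:C) <= C1 * e ^+ m.+2.
  have Qt : cabs (Q t%:C) <= N ^+ n.
    rewrite /Q (big_morph _ (@cabsM R) (cabs1 R)) -[n in _ ^+ n]card_ord -prodr_const.
    apply: ler_prod => j _; rewrite cabs_ge0 /=.
    rewrite -(rmorph_nat (real_complex R)) -rmorphB cabs_real.
    have jN : j%:R <= N - 1 by rewrite lerBrDr natr1 ler_nat.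
    have j0 : 0 <= j%:R :> R by [].
    move/andP: t01 => [t0 t1]; rewrite ler_norml; lra.
  apply: (@le_trans _ _ (B * N ^+ n)); last first.
    rewrite /B /C1 TE le_eqVlt; apply/orP; left; apply/eqP.
    rewrite (exprS e m.+1) -/n.
    have -> : (eta / (8 * N * e) / 2) ^+ n = ((16 * N / eta) ^+ n * e ^+ n)^-1.
      by rewrite -exprMn -exprVn; congr (_ ^+ n); field; rewrite !gt_eqF.
    by rewrite invrK; ring.
  apply: vnorm_le => [|j]; first by rewrite mulr_ge0 // exprn_ge0 // ltW.
  apply: (@le_trans _ _ (B * cabs (Q t%:C))); last by rewrite ler_wpM2l.
  apply: (@quotient_maximum _ (fun s => G s 0 j) Q T) => //.
  - by move=> s sT; exact: GJ.
  - move=> s sT; have QsT := QT s sT; split.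
      by rewrite -cabs_gt0; apply: lt_le_trans QsT; rewrite exprn_gt0.
    apply: le_trans (cabs_coord _ _) _; apply: le_trans (GT s _) _;
      first by rewrite sT.
    by rewrite /B mulrAC ler_pdivlMr ?exprn_gt0 // ler_wpM2l // mulr_ge0
      ?addr_ge0 ?mulr_ge0 ?(ltW N0).
  - move=> s sT /eqP; rewrite /Q prodf_seq_eq0 => /hasP[i _ /=].
    rewrite subr_eq0 => /eqP sE.
    have Gs0 : G s 0 j = 0 by rewrite sE G_nat // mxE.
    have [c c0 Hc] := prod_shift_near (ltn_ord i).
    have [K [h [K0 h0 HK]]] := jet2_order_ge1 (GJ s (ltW sT) j).
    exists (K / c); first by rewrite divr_ge0 // ltW.
    exists (Num.min h 2^-1); first by rewrite lt_min h0 invr_gt0 /=.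
    move=> z; rewrite lt_min => /andP[/HK]; rewrite Gs0 subr0 expr1 sE => Kz zi.
    apply: le_trans Kz _; rewrite -mulrA ler_wpM2l //.
    by rewrite mulrC ler_pdivlMr // mulrC; exact: Hc.
rewrite DE mulrDl; apply: le_trans (vnormB _ _) _; apply: lerD => //.
have -> : C2 * e ^+ m.+2 = N * (N * (e * p ^+ n)).
  have -> : p = 2 / eta * e by rewrite /p mulrAC.
  rewrite /C2 (exprS e n); move: (2 / eta) => q.
  by rewrite exprMn; move: (q ^+ n) (e ^+ n) => u v; ring.
apply: le_trans (vnorm_sum _ _ _) _.
apply: (@le_trans _ _ (\sum_(1 <= k < n.+1) N * (e * p ^+ n))); last first.
  by rewrite sumr_const_nat subSS subn0 -[_ *+ n]mulr_natl.
apply: ler_sum_nat => -[|k] // /andP[_ kn]; apply: le_trans (vnorm_sum _ _ _) _.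
apply: (@le_trans _ _ (\sum_(n.+1 - k.+1 <= i < n) e * p ^+ n)); last first.
  rewrite sumr_const_nat -mulr_natl ler_wpM2r ?mulr_ge0 ?exprn_ge0 //.
  by rewrite ler_nat leq_subr.
apply: ler_sum_nat => i /andP[ki i_n]; rewrite vnormZ cabsM cabs_log_coef.
rewrite -[leRHS]mul1r; apply: ler_pM;
  rewrite ?mulr_ge0 ?invr_ge0 ?cabs_ge0 ?vnorm_ge0 //.
  rewrite nbin_real cabs_real mulr_ile1 ?invr_ge0 //; last exact: nbin_unit_le1.
  by rewrite invf_le1 ?ltr0n // ler1n.
rewrite addSn; apply: le_trans (HDy _ _) _; first exact: leq_add.
rewrite ler_wpM2l // ler_wiXn2l //.
by rewrite subSS leq_subLR in ki.
Qed.

End SmallDefect.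

(** * The defect for all admissible displacements *)

Section DefectBound.
Local Open Scope complex_scope.
Variables (R : realType) (d : nat).
Implicit Types (F : Cd R d -> Cd R d) (y z : Cd R d) (s a mu :
  R[i]) (e delta eps t : R).

Lemma relaxed_hol mu F z : hol_at F z -> hol_at (relaxed mu F) z.
Proof.
move=> HF w a waz wJ; apply: jet2vD => //; apply: jet2vZ; first exact: jet2_cst.
by apply: jet2vB => //; exact: HF.
Qed.

Lemma relaxed_near mu F z : vnorm (relaxed mu F z - z) = cabs mu * vnorm (F z - z).
Proof. by rewrite /relaxed addrAC subrr add0r vnormZ. Qed.

Lemma defect_bound F y m eps delta t : 0 < eps -> 0 < delta ->
  6 * m.+1%:R * eps <= delta ->
  (forall z, vnorm (z - y) < delta -> hol_at F z) ->
  (forall z, vnorm (z - y) < delta -> vnorm (F z - z) <= eps) ->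
  0 <= t <= 1 ->
  vnorm (defect F y m.+2 t%:C) <= 5 / 2 * eps * (6 * m.+1%:R * eps / delta) ^+ m.+2.
Proof.
move=> eps0 delta0 me holF nearF t01.
have M1 : 1 <= m.+1%:R :> R by rewrite ler1n.
have M0 : 0 < 6 * m.+1%:R :> R by rewrite mulr_gt0 ?ltr0n.
(* The largest radius on which [interp_bounds] applies to all the maps F_mu, whose displacement is
   at most |mu| eps. *)
have [mu0 muE] : exists mu0 : R, mu0 = delta / (6 * m.+1%:R * eps) by eexists.
have Me0 : 0 < 6 * m.+1%:R * eps by rewrite mulr_gt0.
have mu00 : 0 < mu0 by rewrite muE divr_gt0.
have mu01 : 1 <= mu0 by rewrite muE ler_pdivlMr // mul1r.
have mueps : 6 * m.+1%:R * (mu0 * eps) = delta.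
  by rewrite muE mulrCA divfK // gt_eqF.
have mule a : cabs a <= mu0 -> 6 * m.+1%:R * (cabs a * eps) <= delta.
  by move=> amu; rewrite -mueps ler_wpM2l ?(ltW M0) // ler_wpM2r // ltW.
have holR a z : vnorm (z - y) < delta -> hol_at (relaxed a F) z.
  by move=> /holF; exact: relaxed_hol.
have nearR a z : vnorm (z - y) < delta ->
  vnorm (relaxed a F z - z) <= cabs a * eps.
  by move=> /nearF H; rewrite relaxed_near ler_wpM2l ?cabs_ge0.
have ae0 a : 0 <= cabs a * eps by rewrite mulr_ge0 ?cabs_ge0 // ltW.
have crude a : cabs a <= mu0 ->
  vnorm (defect (relaxed a F) y m.+2 t%:C) <= 5 / 2 * (cabs a * eps).
  move=> /mule amu.
  have [H1 H2 H3] := interp_bounds (ae0 a) (holR a) (nearR a) amu delta0.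
  apply: le_trans (vnormB _ _) _.
  have -> : 5 / 2 * (cabs a * eps) = 5 / 4 * (cabs a * eps) + 5 / 4 * (cabs a * eps) by field.
  apply: lerD; first exact: H3.
  apply: H1; apply: le_lt_trans (H2 _ t01) _.
  have := ae0 a; have : cabs a * eps <= m.+1%:R * (cabs a * eps)
    by rewrite ler_peMl.
  move: amu; rewrite -mulrA; lra.
pose phi s := defect (relaxed s F) y m.+2 t%:C.
have iter_hol a z j : cabs a <= mu0 -> (j < m.+2)%N ->
  vnorm (z - y) < delta / 3 ->
    hol_at F (iter j (relaxed a F) z).
  move=> /mule amu jm zy; apply: holF.
  have Hj : vnorm (z - y) + j%:R * (cabs a * eps) < delta.
    have : j%:R * (cabs a * eps) <= m.+1%:R * (cabs a * eps)
      by rewrite ler_wpM2r // ler_nat.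
    move: amu; rewrite -mulrA; lra.
  by have [] := iter_near (ae0 a) (nearR a) Hj.
have yy : vnorm (y - y) < delta / 3 by rewrite subrr vnorm0 divr_gt0.
have diffJ k a : cabs a <= mu0 -> (k <= m.+2)%N ->
    jet2v (fun s => newton_diff (relaxed s F) k y) a.
  move=> amu km; apply: (@newton_diff_jet2v _ _ F k (fun s => s) (fun=> y)).
  - exact: jet2_id.
  - exact: jet2v_cst.
  - by move=> j jk; apply: iter_hol => //; exact: leq_trans km.
have sumJ (c : nat -> R[i]) a : cabs a <= mu0 ->
    jet2v (fun s => \sum_(0 <= k < m.+3) c k *: newton_diff (relaxed s F) k y) a.
  move=> amu.
  have E s : \sum_(0 <= k < m.+3) c k *: newton_diff (relaxed s F) k y =
      \sum_(0 <= k < m.+3 | (k < m.+3)%N) c k *: newton_diff (relaxed s F) k y.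
    by rewrite -(big_nat_widen 0 m.+3 m.+3 xpredT).
  move=> j; apply: eq_jet2; first by move=> s; rewrite E.
  move: j; rewrite -/(jet2v _ a).
  apply: jet2v_sum => k km; apply: jet2vZ; first exact: jet2_cst.
  exact: diffJ.
have phiJ a : cabs a <= mu0 -> jet2v phi a.
  move=> amu; apply: jet2vB; first exact: sumJ.
  apply: (@interp_field_jet2v _ _ F m.+2 (fun s => s) (fun s => interp_curve
    (relaxed s F) y m.+2 t%:C)).
  - exact: jet2_id.
  - exact: sumJ.
  move=> j jm; apply: iter_hol => //.
  have [_ H2 _] := interp_bounds (ae0 a) (holR a) (nearR a) (mule a amu) delta0.
  apply: le_lt_trans (H2 _ t01) _.
  have := ae0 a; have : cabs a * eps <= m.+1%:R * (cabs a * eps)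
    by rewrite ler_peMl.
  have := mule a amu; rewrite -mulrA; lra.
have [C [E0 [C0 E00 HC]]] := @defect_small R d m.+1 delta delta0.
have -> : defect F y m.+2 t%:C = phi 1 by rewrite /phi relaxed1.
have rhs0 : 0 <= 5 / 2 * eps * (6 * m.+1%:R * eps / delta) ^+ m.+2.
  apply: mulr_ge0; first by rewrite mulr_ge0 ?divr_ge0 // ltW.
  by rewrite exprn_ge0 // divr_ge0 // ltW.
apply: vnorm_le => // j.
(* The vanishing order is m + 3, one more than the order of the field; the extra power pays for the
   factor mu_0 in the bound on the circle. *)
have -> : 5 / 2 * eps * (6 * m.+1%:R * eps / delta) ^+ m.+2 =
    5 / 2 * (mu0 * eps) * (cabs 1 / mu0) ^+ m.+3.
  have -> : 6 * m.+1%:R * eps / delta = mu0^-1 by rewrite muE invf_div.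
  rewrite cabs1 div1r (exprS _ m.+2); move: (_ ^+ m.+2) => u; field.
  by rewrite gt_eqF.
apply: (@schwarz_pow _ (fun s => phi s 0 j)) => //.
- by rewrite mulr_ge0 ?divr_ge0 // mulr_ge0 // ltW.
- by move=> a /phiJ; exact.
- by move=> s sE; apply: le_trans (cabs_coord _ _) _; rewrite -sE; apply: crude;
  rewrite sE.
- exists (C * eps ^+ m.+3), (Num.min mu0 (E0 / eps)); split.
  + by rewrite mulr_ge0 // exprn_ge0 // ltW.
  + by rewrite lt_min mu00 divr_gt0.
  move=> s; rewrite subr0 lt_min ltr_pdivlMr // => /andP[/ltW smu /ltW sE].
  apply: le_trans (cabs_coord _ _) _.
  (* [defect_small] asks for e > 0, so mu = 0 is left to the crude bound, which is 0 there. *)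
  have [s0|s0] := eqVneq s 0.
    apply: le_trans (crude _ smu) _.
    by rewrite s0 cabs0 mul0r mulr0 expr0n /= mulr0.
  rewrite -mulrA -exprMn [eps * _]mulrC; apply: HC => //.
  + by rewrite sE andbT mulr_gt0 // cabs_gt0.
  + exact: holR.
  + exact: nearR.
- by rewrite cabs1.
Qed.

End DefectBound.

(** * Differential equations on the unit interval *)

Section UnitIntervalDerivative.
Local Open Scope complex_scope.
Variables (R : realType) (d : nat).
Implicit Types (g w : R -> Cd R d) (v x y z : Cd R d) (s t u e : R).

(* One-sided at 0 and 1. *)
Definition unit_derivative g s v : Prop := forall e, 0 < e ->
  exists2 eta : R, 0 < eta &
  forall u, 0 <= u <= 1 -> `|u - s| < eta ->
    vnorm (g u - g s - (u - s)%:C *: v) <= e * `|u - s|.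

Lemma unit_derivativeP g s v :
  ((u - s)^-1)%:C *: (g u - g s) @[u --> within `[0, 1] s^'] --> v <->
  unit_derivative g s v.
Proof.
have quot u : u - s != 0 -> vnorm (v - ((u - s)^-1)%:C *: (g u - g s)) * `|u - s| =
    vnorm (g u - g s - (u - s)%:C *: v).
  move=> us; rewrite vnormC -cabs_real mulrC -vnormZ; congr vnorm.
  by rewrite scalerBr scalerA -rmorphM divff // rmorph1 scale1r.
split=> [/cvgrPdist_lt H e e0|H].
  have e0' : 0 < e%:C by rewrite ltcR.
  have := H _ e0'; rewrite near_withinE => /nbhs_ballP[eta eta0 Heta].
  exists eta => // u u01 us; have [E|us0] := eqVneq u s.
    by rewrite E !subrr scale0r subr0 vnorm0 normr0 mulr0.
  rewrite -quot ?subr_eq0 // ler_wpM2r // ltW // -ltcR -norm_vnorm.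
  by apply: Heta => //=; rewrite -ball_normE /= distrC.
apply/cvgrPdist_lt => e e0.
have [eR eE] : exists eR : R, e = eR%:C by exists (complex.Re e);
  rewrite RRe_real // gtr0_real.
rewrite eE ltcR in e0; have [eta eta0 Heta] := H (eR / 2) (divr_gt0 e0 (ltr0n _ 2)).
rewrite near_withinE; apply/nbhs_ballP; exists eta => // u;
  rewrite -ball_normE /= => us us0.
move=> u01; rewrite eE norm_vnorm ltcR.
have us1 : 0 < `|u - s| by rewrite normr_gt0 subr_eq0.
rewrite -(ltr_pM2r us1) quot ?subr_eq0 //.
apply: le_lt_trans (Heta u u01 _) _; first by rewrite distrC.
by rewrite ltr_pM2r //; lra.
Qed.

Lemma unit_derivativeB g h s v v' : unit_derivative g s v ->
  unit_derivative h s v' ->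
  unit_derivative (fun t => g t - h t) s (v - v').
Proof.
move=> gv hw e e0; have e20 : 0 < e / 2 by rewrite divr_gt0.
have [a a0 Ha] := gv _ e20; have [b b0 Hb] := hw _ e20.
exists (Num.min a b); first by rewrite lt_min a0.
move=> u u01; rewrite lt_min => /andP[/(Ha u u01) gu /(Hb u u01) hu].
have -> : g u - h u - (g s - h s) - (u - s)%:C *: (v - v') =
    (g u - g s - (u - s)%:C *: v) - (h u - h s - (u - s)%:C *: v').
  rewrite scalerBr; move: (_ *: v) (_ *: v') => p q.
  by rewrite !opprD !opprK [X in X + _ = _]addrACA [LHS]addrACA.
by apply: le_trans (vnormB _ _) _; lra.
Qed.

Lemma unit_derivative_lip g s v : unit_derivative g s v -> forall e, 0 < e ->
  exists2 eta : R, 0 < eta & forall u, 0 <= u <= 1 -> `|u - s| < eta ->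
    vnorm (g u - g s) <= (vnorm v + e) * `|u - s|.
Proof.
move=> gv e /gv[eta eta0 H]; exists eta => // u u01 us.
rewrite -[g u - g s](subrK ((u - s)%:C *: v)); apply: le_trans (vnormD _ _) _.
by rewrite mulrDl addrC; apply: lerD;
  [rewrite vnormZ cabs_real mulrC | exact: H].
Qed.

Lemma unit_derivative_cst x s : unit_derivative (fun=> x) s 0.
Proof.
move=> e e0; exists 1 => // u _ _.
by rewrite subrr scaler0 subr0 vnorm0 mulr_ge0 // ltW.
Qed.

(* First exit: at the supremum of the times up to which the bound holds, the
   derivative of |w| is at most |w'|, which is less than that of the bound. *)
Lemma comparison w (w' : R -> Cd R d) (a b : R) : 0 <= a -> 0 <= b -> w 0 = 0 ->
  (forall s, 0 <= s <= 1 -> unit_derivative w s (w' s)) ->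
  (forall s, 0 <= s <= 1 -> vnorm (w s) = a * s + b * s ^+ 2 ->
     vnorm (w' s) < a + 2 * b * s) ->
  forall t, 0 <= t <= 1 -> vnorm (w t) <= a * t + b * t ^+ 2.
Proof.
move=> a0 b0 w0 dw Hw; pose y s := a * s + b * s ^+ 2.
have ymono s u : 0 <= s -> s <= u -> y s <= y u.
  by move=> s0 su; rewrite /y lerD // ler_wpM2l // lerXn2r ?nnegrE // (le_trans s0).
pose S : set R := [set t | 0 <= t <= 1 /\ forall s, 0 <= s <= t ->
  vnorm (w s) <= y s].
have S0 : S 0.
  split; first by rewrite lexx ler01.
  move=> s /andP[s0 s1]; have -> : s = 0 by apply/eqP; rewrite eq_le s1.
  by rewrite w0 vnorm0 /y mulr0 expr0n /= mulr0 addr0.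
have supS : has_sup S by split; [exists 0 | exists 1 => t [/andP[]]].
pose q := sup S.
have q0 : 0 <= q by apply: sup_upper_bound S0.
have q1 : q <= 1 by apply: sup_le_ub; [exists 0 | move=> t [/andP[]]].
have q01 : 0 <= q <= 1 by rewrite q0.
have below s : 0 <= s -> s < q -> vnorm (w s) <= y s.
  move=> s0 sq; have [t [_ tS] st] : exists2 t, S t & s < t.
    have [|t St] := @sup_adherent _ S (q - s) _ supS; first by rewrite subr_gt0.
    by rewrite -/q opprB addrCA subrr addr0; exists t.
  by apply: tS; rewrite s0 ltW.
have lip : exists2 eta : R, 0 < eta & forall u, 0 <= u <= 1 -> `|u - q| < eta ->
    vnorm (w u - w q) <= (vnorm (w' q) + 1) * `|u - q|.
  exact: unit_derivative_lip (dw q q01) _ ltr01.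
have L0 : 0 < vnorm (w' q) + 1 by rewrite ltr_wpDl // vnorm_ge0.
(* Continuity from the left: a step h back from q changes w by less than the supposed gap, while the
   bound already holds at q - h. *)
have wq : vnorm (w q) <= y q.
  rewrite leNgt; apply/negP => gap.
  have qpos : 0 < q.
    by rewrite lt_def q0 andbT; apply: contraTneq gap => ->;
      rewrite w0 vnorm0 /y mulr0 expr0n /= mulr0 addr0 ltxx.
  have [eta eta0 H] := lip.
  pose h := Num.min (Num.min (eta / 2) q) ((vnorm (w q) - y q) / (vnorm (w' q) + 1) / 2).
  have h0 : 0 < h by rewrite !lt_min qpos !divr_gt0 ?subr_gt0.
  have hq : h <= q by rewrite !ge_min lexx orbT.
  have heta : h < eta.
    have : h <= eta / 2 by rewrite !ge_min lexx.
    by lra.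
  have hgap : (vnorm (w' q) + 1) * h < vnorm (w q) - y q.
    have : h <= (vnorm (w q) - y q) / (vnorm (w' q) + 1) / 2
      by rewrite !ge_min lexx !orbT.
    rewrite -mulrA -invfM ler_pdivlMr ?mulr_gt0 // => hh.
    have : 0 < (vnorm (w' q) + 1) * h by rewrite mulr_gt0.
    by lra.
  clearbody h.
  have qh : `|q - h - q| = h by rewrite addrAC subrr add0r normrN gtr0_norm.
  have := H (q - h); rewrite qh => /(_ _ heta) Hh.
  have {}Hh : vnorm (w (q - h) - w q) <= (vnorm (w' q) + 1) * h by apply: Hh;
    apply/andP; split; lra.
  have B := below (q - h); have {}B : vnorm (w (q - h)) <= y (q - h)
    by apply: B; lra.
  have M : y (q - h) <= y q by apply: ymono; lra.
  have := vnormB (w (q - h)) (w (q - h) - w q); rewrite opprB addrC subrK; lra.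
have upto s : 0 <= s <= q -> vnorm (w s) <= y s.
  move=> /andP[s0]; rewrite le_eqVlt => /predU1P[-> //|]; exact: below.
suff qE : q = 1 by move=> t t01; apply: upto; rewrite qE.
apply/eqP; rewrite eq_le q1 leNgt; apply/negP => qlt.
have [eta eta0 ext] : exists2 eta : R, 0 < eta & forall u, q <= u -> u <= 1 ->
  u - q < eta ->
    vnorm (w u) <= y u.
  (* At contact the slope of w is strictly below that of the barrier, and the difference serves as
     the error in the derivative; without contact, continuity is enough. *)
  move: wq; rewrite le_eqVlt => /predU1P[wqE|gap].
    have k0 : 0 < a + 2 * b * q - vnorm (w' q) by rewrite subr_gt0; exact: Hw.
    have [eta eta0 H] := unit_derivative_lip (dw q q01) k0.
    exists eta => // u qu u1 ueta.
    have uq : `|u - q| = u - q by rewrite ger0_norm ?subr_ge0.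
    have := H u; rewrite uq => /(_ _ ueta) Hu.
    have {}Hu : vnorm (w u - w q) <= (vnorm (w' q) + (a + 2 * b * q - vnorm (w' q))) * (u - q).
      by apply: Hu; apply/andP; split; lra.
    have := vnormD (w u - w q) (w q); rewrite subrK wqE /y => Hv.
    have : 0 <= b * (u - q) ^+ 2 by rewrite mulr_ge0 ?sqr_ge0.
    move: Hu Hv; set A := vnorm (w u); set B := vnorm _ ;
      move: (vnorm (w' q)) => C; nra.
  have [eta eta0 H] := lip.
  exists (Num.min eta ((y q - vnorm (w q)) / (vnorm (w' q) + 1))).
    by rewrite lt_min eta0 divr_gt0 // subr_gt0.
  move=> u qu u1; rewrite lt_min => /andP[ueta]; rewrite ltr_pdivlMr // => ugap.
  have uq : `|u - q| = u - q by rewrite ger0_norm ?subr_ge0.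
  have := H u; rewrite uq => /(_ _ ueta) Hu.
  have {}Hu : vnorm (w u - w q) <= (vnorm (w' q) + 1) * (u - q) by apply: Hu;
    apply/andP; split; lra.
  have := vnormD (w u - w q) (w q); rewrite subrK.
  have := ymono _ _ q0 qu; lra.
pose h := Num.min (eta / 2) (1 - q).
have h0 : 0 < h by rewrite lt_min divr_gt0 // subr_gt0.
have h1 : h <= 1 - q by rewrite ge_min lexx orbT.
have h2 : h < eta.
  have : h <= eta / 2 by rewrite ge_min lexx.
  by lra.
clearbody h.
have : q + h <= q.
  apply: sup_upper_bound => //; split; first by apply/andP; split; lra.
  move=> s /andP[s0 sh]; have [sq|qs] := lerP s q; first by apply: upto;
    rewrite s0.
  by apply: ext; lra.
by lra.
Qed.

(** A quadratic barrier (e + k)(s + L c s^2) replaces the exponential. The choice c = 1/(2 - L)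
    gives 1 + L c = 2 c, hence L (s + L c s^2) <= 2 L c s on [0, 1], and the slack k > 0 makes the
    inequality at contact strict. At s = 1 the barrier is (e + k) / (1 - L/2). *)
Lemma gronwall w (w' : R -> Cd R d) (L e : R) : 0 <= L <= 1 -> 0 <= e ->
  w 0 = 0 ->
  (forall s, 0 <= s <= 1 -> unit_derivative w s (w' s)) ->
  (forall s, 0 <= s <= 1 -> vnorm (w' s) <= L * vnorm (w s) + e) ->
  forall t, 0 <= t <= 1 -> vnorm (w t) <= e / (1 - L / 2).
Proof.
move=> /andP[L0 L1] e0 w0 dw Hw t t01.
have D0 : 0 < 1 - L / 2 by lra.
rewrite ler_pdivlMr //; apply/ler_addgt0Pr => k k0.
have [c cE] : exists c : R, c = (2 - L)^-1 by eexists.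
have c0 : 0 < c by rewrite cE invr_gt0; lra.
have cL : c * (2 - L) = 1 by rewrite cE mulVf // gt_eqF //; lra.
have ek : 0 <= e + k by lra.
have Lc : 0 <= L * c by rewrite mulr_ge0 // ltW.
have := @comparison w w' (e + k) ((e + k) * (L * c)) ek (mulr_ge0 ek Lc) w0 dw.
move=> /(_ _ t t01) H.
have {}H : vnorm (w t) <= (e + k) * t + (e + k) * (L * c) * t ^+ 2.
  apply: H => s s01 ws; apply: le_lt_trans (Hw s s01) _.
  have -> : L * vnorm (w s) + e = (e + k) * (L * s * (1 + L * c * s)) + e.
    by rewrite ws; ring.
  have -> : e + k + 2 * ((e + k) * (L * c)) * s = (e + k) * (L * s * (2 * c)) + (e + k) by ring.
  move/andP: s01 => [s0 s1].
  have Lcs : L * c * s <= L * c by rewrite ler_piMr.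
  have : (e + k) * (L * s * (1 + L * c * s)) <= (e + k) * (L * s * (2 * c)).
    rewrite !ler_wpM2l ?mulr_ge0 //; lra.
  lra.
have {}H : vnorm (w t) <= (e + k) * (2 * c).
  apply: le_trans H _; move/andP: t01 => [t0 t1].
  have t2 : t ^+ 2 <= 1 by rewrite expr_le1.
  have : (e + k) * (L * c) * t ^+ 2 <= (e + k) * (L * c)
    by rewrite ler_piMr // mulr_ge0.
  have : (e + k) * t <= e + k by rewrite ler_piMr.
  have -> : (e + k) * (2 * c) = (e + k) + (e + k) * (L * c).
    have -> : 2 * c = 1 + L * c by lra.
    by ring.
  lra.
have -> : e + k = (e + k) * (2 * c) * (1 - L / 2).
  have -> : (e + k) * (2 * c) * (1 - L / 2) = (e + k) * (c * (2 - L)) by field.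
  by rewrite cL mulr1.
by rewrite ler_wpM2r // ltW.
Qed.

(** [comparison] with the linear barrier (b + k) s. The field is controlled only in the ball of
    radius rho, but the barrier stays below rho, so the speed bound is available at every
    contact. *)
Lemma confinement g (X : Cd R d -> Cd R d) x (b rho : R) : 0 <= b -> b < rho ->
  g 0 = x ->
  (forall s, 0 <= s <= 1 -> unit_derivative g s (X (g s))) ->
  (forall z, vnorm (z - x) < rho -> vnorm (X z) <= b) ->
  forall t, 0 <= t <= 1 -> vnorm (g t - x) <= b.
Proof.
move=> b0 brho g0 dg HX t t01; apply/ler_addgt0Pr => k0 k00.
pose k := Num.min k0 ((rho - b) / 2).
have kpos : 0 < k by rewrite lt_min k00 divr_gt0 // subr_gt0.
have kk0 : k <= k0 by rewrite ge_min lexx.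
have krho : b + k < rho.
  have : k <= (rho - b) / 2 by rewrite ge_min lexx orbT.
  by lra.
clearbody k; have bk0 : 0 <= b + k by lra.
have dw s : 0 <= s <= 1 -> unit_derivative (fun t => g t - x) s (X (g s)).
  move=> s01; rewrite -[X (g s)]subr0; apply: unit_derivativeB; first exact: dg.
  exact: unit_derivative_cst.
have := @comparison _ _ (b + k) 0 bk0 (lexx 0) _ dw.
rewrite g0 subrr => /(_ erefl _ t t01) H.
have {}H : vnorm (g t - x) <= (b + k) * t + 0 * t ^+ 2.
  apply: H => s /andP[s0 s1] E; rewrite mulr0 mul0r addr0.
  apply: le_lt_trans (HX _ _) _; last by lra.
  by rewrite E mul0r addr0; apply: le_lt_trans krho; rewrite ler_piMr.
apply: le_trans H _; rewrite mul0r addr0; move/andP: t01 => [t0 t1].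
by apply: (@le_trans _ _ (b + k)); [rewrite ler_piMr | lra].
Qed.

End UnitIntervalDerivative.

(** * Primitives and geometric limits *)

Section Primitive.
Local Open Scope complex_scope.
Variable R : realType.

(** Extends a function on [0, 1] continuously to the line, so that with integration over [-1, 2] the
    end points 0 and 1 become interior for the fundamental theorem of calculus. *)
Definition clamp (s : R) : R := Num.max 0 (Num.min s 1).

Lemma clamp_unit s : 0 <= clamp s <= 1.
Proof. by rewrite /clamp le_max lexx ge_max ler01 ge_min lexx orbT. Qed.

Lemma clamp_id s : 0 <= s <= 1 -> clamp s = s.
Proof. by move=> /andP[s0 s1]; rewrite /clamp (min_idPl s1) (max_idPr s0). Qed.

Lemma clamp_lip s t : `|clamp s - clamp t| <= `|s - t|.
Proof.
have st := ler_norm (s - t); have := ler_norm (- (s - t)); rewrite normrN => ts.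
rewrite /clamp; case: (lerP s 1) => s1; case: (lerP t 1) => t1;
  rewrite ?(max_idPr (@ler01 R)); case: (lerP 0 s) => s0;
    case: (lerP 0 t) => t0;
  by rewrite ler_norml; apply/andP; split; lra.
Qed.

Lemma real_primitive (f : R -> R) :
  (forall s, 0 <= s <= 1 -> forall e, 0 < e -> exists2 eta : R, 0 < eta &
    forall u, 0 <= u <= 1 -> `|u - s| < eta -> `|f u - f s| < e) ->
  exists P : R -> R, forall s, 0 <= s <= 1 -> forall e, 0 < e ->
    exists2 eta : R, 0 < eta &
    forall u, 0 <= u <= 1 -> `|u - s| < eta ->
      `|P u - P s - (u - s) * f s| <= e * `|u - s|.
Proof.
move=> cf; pose h s := f (clamp s).
have ch : continuous h.
  move=> s; apply/cvgrPdist_lt => e e0.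
  have [eta eta0 H] := cf _ (clamp_unit s) _ e0.
  apply/nbhs_ballP; exists eta => // u us.
  rewrite distrC; apply: H; first exact: clamp_unit.
  by apply: le_lt_trans (clamp_lip _ _) _; rewrite distrC; exact: us.
pose mu := @lebesgue_measure R.
have hint : mu.-integrable `[-1, 2] (EFin \o h).
  apply: continuous_compact_integrable; first exact: segment_compact.
  by apply: continuous_subspaceT.
pose P (x : R) : R := (\int[mu]_(t in `[-1, x]) h t)%R.
exists P => s s01 e e0.
have [dP PE] : derivable P s 1 /\ derive1 P s = h s.
  apply: (@continuous_FTC1_closed R h (-1) s 2) => //.
  - by move/andP: s01 => [_ s1]; lra.
  - by move/andP: s01 => [s0 _]; lra.
  - exact: ch.
have hs : h s = f s by rewrite /h clamp_id.
move: dP => /cvg_ex[l Hl].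
have lE : l = f s by rewrite -hs -PE derive1E; apply/esym/cvg_lim => //.
move/cvgrPdist_lt : Hl => /(_ e e0) /nbhs_ballP[eta eta0 H].
exists eta => // u u01 us; have [->|us0] := eqVneq u s.
  by rewrite !subrr mul0r subr0 normr0 mulr0.
have us1 : u - s != 0 by rewrite subr_eq0.
have bus : ball 0 eta (u - s) by rewrite /ball /= sub0r normrN.
have := H (u - s) bus us1.
rewrite /GRing.scale /= mulr1 subrK lE => Hlt.
have -> : P u - P s - (u - s) * f s = - ((f s - (u - s)^-1 * (P u - P s)) * (u - s)).
  by field; rewrite us1.
by rewrite normrN normrM ler_wpM2r // ltW.
Qed.

(** The intervals of centre u_n and radius 2 c 2^-n are nested; the limit is the supremum of their
    left ends. *)
Lemma geometric_limit (u : nat ->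
  R) (c : R) : (forall n, `|u n.+1 - u n| <= c * 2^-1 ^+ n) ->
  exists l, forall n, `|u n - l| <= 2 * c * 2^-1 ^+ n.
Proof.
move=> H.
have q0 n : 0 <= 2^-1 ^+ n :> R by rewrite exprn_ge0 // invr_ge0.
have c0 : 0 <= c by have := H 0%N; rewrite expr0 mulr1; apply: le_trans.
pose a n := u n - 2 * c * 2^-1 ^+ n; pose b n := u n + 2 * c * 2^-1 ^+ n.
have aS n : a n <= a n.+1.
  by have := H n; rewrite /a exprS ler_norml; set q := 2^-1 ^+ n; lra.
have bS n : b n.+1 <= b n.
  by have := H n; rewrite /b exprS ler_norml; set q := 2^-1 ^+ n; lra.
have amono n k : a n <= a (n + k)%N.
  by elim: k => [|k IH]; rewrite ?addn0 // addnS (le_trans IH).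
have bmono n k : b (n + k)%N <= b n.
  by elim: k => [|k IH]; rewrite ?addn0 // addnS (le_trans _ IH).
have ab n k : a n <= b k.
  apply: le_trans (amono n k) _; rewrite addnC; apply: le_trans (bmono k n).
  by rewrite /a /b lerD2l; have := mulr_ge0 c0 (q0 (k + n)%N); lra.
pose S : set R := [set a n | n in [set: nat]].
have Sub k : ubound S (b k) by move=> _ [n _ <-].
have supS : has_sup S by split; [exists (a 0%N); exists 0%N | exists (b 0%N)].
exists (sup S) => n; rewrite ler_norml; apply/andP; split.
  have := sup_le_ub supS.1 (Sub n); rewrite /b; lra.
have : a n <= sup S by apply: sup_upper_bound => //; exists n.
rewrite /a; lra.
Qed.

End Primitive.

(** * Existence, uniqueness and comparison of solutions *)

Section Picard.
Local Open Scope complex_scope.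
Variables (R : realType) (d : nat).
Implicit Types (G : R -> Cd R d) (x y z : Cd R d).

Definition unit_continuous G : Prop := forall s, 0 <= s <= 1 ->
  forall e : R, 0 < e ->
  exists2 eta : R, 0 < eta &
    forall u, 0 <= u <= 1 -> `|u - s| < eta -> vnorm (G u - G s) < e.

Lemma unit_derivative_continuous G (G' : R -> Cd R d) :
  (forall s, 0 <= s <= 1 -> unit_derivative G s (G' s)) -> unit_continuous G.
Proof.
move=> dG s s01 e e0; have [eta eta0 H] := unit_derivative_lip (dG s s01) ltr01.
have L0 : 0 < vnorm (G' s) + 1 by rewrite ltr_wpDl // vnorm_ge0.
exists (Num.min eta (e / (vnorm (G' s) + 1)));
  first by rewrite lt_min eta0 divr_gt0.
move=> u u01; rewrite lt_min ltr_pdivlMr // => /andP[/(H u u01) Hu].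
by rewrite mulrC; exact: le_lt_trans.
Qed.

Lemma primitive G : unit_continuous G ->
  exists P : R -> Cd R d, P 0 = 0 /\ forall s, 0 <= s <= 1 ->
    unit_derivative P s (G s).
Proof.
move=> cG.
have part (p : {additive R[i] -> R}) : (forall c, `|p c| <= cabs c) ->
  forall j : 'I_d,
    exists P : R -> R, forall s, 0 <= s <= 1 -> forall e, 0 < e ->
    exists2 eta : R, 0 < eta & forall u, 0 <= u <= 1 -> `|u - s| < eta ->
      `|P u - P s - (u - s) * p (G s 0 j)| <= e * `|u - s|.
  move=> pc j; apply: (@real_primitive R (fun s => p (G s 0 j))) => s s01 e e0.
  have [eta eta0 H] := cG s s01 e e0; exists eta => // u u01 us.
  rewrite -raddfB; apply: le_lt_trans (pc _) _.
  have -> : G u 0 j - G s 0 j = (G u - G s) 0 j by rewrite !mxE.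
  exact: le_lt_trans (cabs_coord _ j) (H u u01 us).
have /choice[A HA] := part (@complex.Re R : {additive R[i] -> R}) (@cabs_Re R).
have /choice[B HB] := part (@complex.Im R : {additive R[i] -> R}) (@cabs_Im R).
pose P s : Cd R d := \row_j ((A j s - A j 0) +i* (B j s - B j 0)).
exists P; split; first by apply/rowP => j; rewrite !mxE !subrr.
move=> s s01 e e0; have e20 : 0 < e / 2 by rewrite divr_gt0.
have /choice[eta Heta] (j : 'I_d) : exists eta : R, 0 < eta /\
    forall u, 0 <= u <= 1 -> `|u - s| < eta ->
    cabs ((P u - P s - (u - s)%:C *: G s) 0 j) <= e * `|u - s|.
  have [a a0 Ha] := HA j s s01 _ e20; have [b b0 Hb] := HB j s s01 _ e20.
  exists (Num.min a b); split; first by rewrite lt_min a0.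
  move=> u u01; rewrite lt_min => /andP[/(Ha u u01) Hau /(Hb u u01) Hbu].
  apply: le_trans (cabs_le_ReIm _) _; rewrite [e in leRHS]splitr mulrDl.
  move: Hau Hbu; rewrite !mxE; case: (G s 0 j) => p q /= Hau Hbu.
  by apply: lerD; [move: Hau | move: Hbu]; apply: le_trans; rewrite le_eqVlt;
    apply/orP; left; apply/eqP; congr `|_|; ring.
exists (\big[Num.min/1]_j eta j); first by apply: lt_bigmin => // j _;
  case: (Heta j).
move=> u u01 /bigmin_gtP[_ us]; apply: vnorm_le => [|j].
  by rewrite mulr_ge0 // ltW.
by have [_ H] := Heta j; apply: H => //; exact: us.
Qed.

Lemma geometric_limitv (u : nat -> Cd R d) (c : R) :
  (forall n, vnorm (u n.+1 - u n) <= c * 2^-1 ^+ n) ->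
  exists l, forall n, vnorm (u n - l) <= 4 * c * 2^-1 ^+ n.
Proof.
move=> H.
have q0 n : 0 <= 2^-1 ^+ n :> R by rewrite exprn_ge0 // invr_ge0.
have c0 : 0 <= c by have := H 0%N; rewrite expr0 mulr1; apply: le_trans;
  exact: vnorm_ge0.
have part (p : {additive R[i] -> R}) : (forall k : R[i], `|p k| <= cabs k) ->
  forall j : 'I_d,
    exists l, forall n, `|p (u n 0 j) - l| <= 2 * c * 2^-1 ^+ n.
  move=> pc j; apply: (@geometric_limit R (fun n => p (u n 0 j))) => n.
  rewrite -raddfB; apply: le_trans (pc _) _.
  have -> : u n.+1 0 j - u n 0 j = (u n.+1 - u n) 0 j by rewrite !mxE.
  exact: le_trans (cabs_coord _ j) (H n).
have /choice[A HA] := part (@complex.Re R : {additive R[i] -> R}) (@cabs_Re R).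
have /choice[B HB] := part (@complex.Im R : {additive R[i] -> R}) (@cabs_Im R).
exists (\row_j (A j +i* B j)) => n; apply: vnorm_le => [|j];
  first by rewrite !mulr_ge0.
apply: le_trans (cabs_le_ReIm _) _; rewrite !mxE.
have := HA j n; have := HB j n; case: (u n 0 j) => p q /=; lra.
Qed.

Lemma picard (X : Cd R d -> Cd R d) x (b L : R) : 0 <= b -> 0 <= L <= 2^-1 ->
  (forall z, vnorm (z - x) <= b -> vnorm (X z) <= b) ->
  (forall p q, vnorm (p - x) <= b -> vnorm (q - x) <= b ->
     vnorm (X p - X q) <= L * vnorm (p - q)) ->
  exists g : R -> Cd R d, [/\ g 0 = x, forall s, 0 <= s <= 1 ->
    vnorm (g s - x) <= b &
    forall s, 0 <= s <= 1 -> unit_derivative g s (X (g s))].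
Proof.
move=> b0 /andP[L0 L1] HX HL.
(* A primitive operator defined on all functions, with arbitrary value off the continuous ones, so
   that the Picard step can be iterated as a total map. *)
have /choice[J HJ] G : exists P : R -> Cd R d, unit_continuous G ->
    P 0 = 0 /\ forall s, 0 <= s <= 1 -> unit_derivative P s (G s).
  have [cG|ncG] := pselect (unit_continuous G); last by exists (fun=> 0).
  by have [P HP] := primitive cG; exists P.
pose inball g := forall s : R, 0 <= s <= 1 -> vnorm (g s - x) <= b.
have cX g : inball g -> unit_continuous g -> unit_continuous (fun s => X (g s)).
  move=> gb cg s s01 e e0; have [eta eta0 H] := cg s s01 e e0.
  exists eta => // u u01 us; apply: le_lt_trans (HL _ _ (gb u u01) (gb s s01)) _.
  apply: le_lt_trans (H u u01 us); rewrite ler_piMl ?vnorm_ge0 //; lra.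
pose step g (s : R) := x + J (fun s => X (g s)) s.
have stepd g : inball g -> unit_continuous g ->
    forall s, 0 <= s <= 1 -> unit_derivative (step g) s (X (g s)).
  move=> gb cg s s01; have [_ /(_ s s01) H] := HJ _ (cX g gb cg).
  move=> e /H[eta eta0 He]; exists eta => // u u01 us.
  by rewrite /step opprD addrACA subrr add0r; exact: He.
have step0 g : inball g -> unit_continuous g -> step g 0 = x.
  by move=> gb cg; have [P0 _] := HJ _ (cX g gb cg); rewrite /step P0 addr0.
have stepb g : inball g -> unit_continuous g -> inball (step g).
  move=> gb cg s s01.
  have dw t : 0 <= t <= 1 -> unit_derivative (fun t => step g t - x) t (X (g t) - 0).
    by move=> t01; apply: unit_derivativeB;
      [exact: stepd | exact: unit_derivative_cst].
  (* With L = 0, [gronwall] is the mean value inequality. *)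
  have := @gronwall _ _ (fun t => step g t - x) _ 0 b _ b0 _ dw.
  rewrite mul0r subr0 divr1 => H; apply: H => //.
  - by rewrite lexx ler01.
  - by rewrite step0 // subrr.
  - by move=> t t01; rewrite subr0 mul0r add0r; apply: HX; exact: gb.
have stepc g : inball g -> unit_continuous g -> unit_continuous (step g).
  by move=> gb cg; apply: unit_derivative_continuous (stepd g gb cg).
have step_contract g h (e : R) : inball g -> unit_continuous g -> inball h ->
  unit_continuous h ->
    0 <= e -> (forall s, 0 <= s <= 1 -> vnorm (g s - h s) <= e) ->
    forall s, 0 <= s <= 1 -> vnorm (step g s - step h s) <= e * 2^-1.
  move=> gb cg hb ch e0 gh s s01.
  have dw t : 0 <= t <= 1 ->
      unit_derivative (fun t => step g t - step h t) t (X (g t) - X (h t)).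
    by move=> t01; apply: unit_derivativeB; exact: stepd.
  have := @gronwall _ _ (fun t => step g t - step h t) _ 0 (e * 2^-1) _ _ _ dw.
  rewrite mul0r subr0 divr1 => H; apply: H => //.
  - by rewrite lexx ler01.
  - by rewrite mulr_ge0 // invr_ge0.
  - by rewrite !step0 // subrr.
  - move=> t t01; rewrite mul0r add0r;
    apply: le_trans (HL _ _ (gb t t01) (hb t t01)) _.
    by rewrite mulrC; apply: ler_pM => //; [exact: vnorm_ge0 | exact: gh].
pose g n := iter n step (fun=> x).
have ginv n : inball (g n) /\ unit_continuous (g n).
  elim: n => [|n [gb cg]] /=; last by split; [exact: stepb | exact: stepc].
  split=> [s _|s s01 e e0]; first by rewrite subrr vnorm0.
  by exists 1 => // u _ _; rewrite subrr vnorm0.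
have gb n := (ginv n).1; have cg n := (ginv n).2.
have gS n s : 0 <= s <= 1 -> vnorm (g n.+1 s - g n s) <= b * 2^-1 ^+ n.
  move=> s01; elim: n s s01 => [|n IHn] s s01.
    by rewrite expr0 mulr1; exact: (gb 1%N).
  rewrite exprSr mulrA.
  apply: (step_contract (g n.+1) (g n)) => //.
  by rewrite mulr_ge0 // exprn_ge0 // invr_ge0.
have /choice[gl Hgl] s : exists l, 0 <= s <= 1 ->
  forall n, vnorm (g n s - l) <= 4 * b * 2^-1 ^+ n.
  have [s01|ns01] := boolP (0 <= s <= 1); last by exists 0.
  have [l Hl] := geometric_limitv (fun n => gS n s s01).
  by exists l.
have small (C e : R) : 0 <= C -> 0 < e -> exists n, C * 2^-1 ^+ n < e.
  move=> C0 e0; exists (Num.bound (C / e)).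
  have Hb : C / e < (Num.bound (C / e))%:R by apply: archi_boundP;
    rewrite divr_ge0 // ltW.
  rewrite exprVn ltr_pdivrMr ?exprn_gt0 //; move: Hb;
    rewrite ltr_pdivrMr // => /lt_trans; apply.
  by rewrite mulrC ltr_pM2l // -natrX ltr_nat ltn_expl.
have C0 : 0 <= 4 * b by rewrite mulr_ge0.
have glb : inball gl.
  move=> s s01; apply/ler_addgt0Pr => e e0; have [n Hn] := small _ _ C0 e0.
  apply: le_trans (vnorm_triangle (g n s) _ _) _; rewrite addrC; apply: lerD.
    exact: gb.
  by rewrite vnormC; apply: le_trans (Hgl s s01 n) (ltW Hn).
have cgl : unit_continuous gl.
  move=> s s01 e e0; have e30 : 0 < e / 3 by rewrite divr_gt0.
  have [n Hn] := small _ _ C0 e30; have [eta eta0 H] := cg n s s01 _ e30.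
  exists eta => // u u01 us; have Hu := H u u01 us.
  have := vnorm_triangle (g n u) (gl u) (gl s).
  have := vnorm_triangle (g n s) (g n u) (gl s).
  have := Hgl s s01 n; have := Hgl u u01 n; rewrite vnormC; lra.
have glE s : 0 <= s <= 1 -> gl s = step gl s.
  move=> s01; apply/eqP; rewrite -subr_eq0; apply/eqP/vnorm_eq0/eqP.
  rewrite eq_le vnorm_ge0 andbT; apply/ler_addgt0Pr => e e0; rewrite add0r.
  have e20 : 0 < e / 2 by rewrite divr_gt0.
  have [n Hn] := small _ _ C0 e20.
  have Cn0 : 0 <= 4 * b * 2^-1 ^+ n
    by rewrite mulr_ge0 // exprn_ge0 // invr_ge0.
  have := step_contract (g n) gl _ (gb n) (cg n) glb cgl Cn0 (fun s s01 => Hgl s s01 n) s s01.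
  have := Hgl s s01 n.+1; rewrite exprSr mulrA -[step (g n) s]/(g n.+1 s) => H1 H2.
  have := vnorm_triangle (g n.+1 s) (gl s) (step gl s).
  rewrite (vnormC (gl s) (g n.+1 s)); lra.
exists (step gl); split; first exact: step0.
  by move=> s s01; rewrite -glE //; exact: glb.
by move=> s s01; rewrite -glE //; exact: stepd.
Qed.

(** Every solution in U is confined to the ball of radius b, where X is Lipschitz, so one Gronwall
    estimate compares it with any approximate solution in that ball. Taking the Picard solution as
    the approximate one, with e = 0, gives uniqueness. *)
Lemma flow_compare (X : Cd R d -> Cd R d) (U : set (Cd R d)) x (b rho L : R) :
  0 <= b -> b < rho -> 0 <= L <= 2^-1 ->
  (forall z, vnorm (z - x) < rho -> U z /\ vnorm (X z) <= b) ->
  (forall p q, vnorm (p - x) <= b -> vnorm (q - x) <= b ->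
     vnorm (X p - X q) <= L * vnorm (p - q)) ->
  flow_dom U X 1 x /\
  forall (c c' : R -> Cd R d) (e : R), 0 <= e -> c 0 = x ->
    (forall s, 0 <= s <= 1 -> [/\ vnorm (c s - x) <= b,
      unit_derivative c s (c' s) &
       vnorm (c' s - X (c s)) <= e]) ->
    vnorm (flow U X 1 x - c 1) <= e / (1 - L / 2).
Proof.
move=> b0 brho L01 HUX HL.
have L1 : 0 <= L <= 1 by move/andP: L01 => [-> L2]; lra.
have i01 : 0 <= (1 : R) <= 1 by rewrite ler01 lexx.
have curve g : integral_curve U X 1 g ->
    forall s, 0 <= s <= 1 -> unit_derivative g s (X (g s)).
  by move=> Hg s s01; have [_ /unit_derivativeP] := Hg s s01.
have compare g : g 0 = x -> integral_curve U X 1 g ->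
    forall (c c' : R -> Cd R d) (e : R), 0 <= e -> c 0 = x ->
    (forall s, 0 <= s <= 1 -> [/\ vnorm (c s - x) <= b,
      unit_derivative c s (c' s) &
       vnorm (c' s - X (c s)) <= e]) ->
    vnorm (g 1 - c 1) <= e / (1 - L / 2).
  move=> g0 Hg c c' e e0 c0 Hc.
  have gb := confinement b0 brho g0 (curve g Hg) (fun z Hz => (HUX z Hz).2).
  have dw s : 0 <= s <= 1 -> unit_derivative (fun s => g s - c s) s (X (g s) - c' s).
    move=> s01; have [_ dc _] := Hc s s01; apply: unit_derivativeB => //;
      exact: curve.
  apply: (gronwall L1 e0 _ dw) => //; first by rewrite g0 c0 subrr.
  move=> s s01; have [cb _ ce] := Hc s s01.
  apply: le_trans (vnorm_triangle (X (c s)) _ _) _.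
  by apply: lerD; [exact: HL (gb s s01) cb | rewrite vnormC].
have [g [g0 gb dg]] : exists g : R -> Cd R d, [/\ g 0 = x,
    forall s, 0 <= s <= 1 -> vnorm (g s - x) <= b &
    forall s, 0 <= s <= 1 -> unit_derivative g s (X (g s))].
  apply: picard L01 _ HL => // z zb; apply: (HUX z _).2;
    exact: le_lt_trans brho.
have Hg : integral_curve U X 1 g.
  move=> s s01; split; last by apply/unit_derivativeP; exact: dg.
  by apply: (HUX (g s) _).1; exact: le_lt_trans (gb s s01) brho.
have flg : flows_to U X 1 x (g 1) by exists g.
split.
  exists (g 1); split => // y [h [h0 <- Hh]].
  have := compare h h0 Hh g (fun s => X (g s)) 0 (lexx 0) g0.
  rewrite mul0r => H; apply/esym/eqP; rewrite -subr_eq0;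
    apply/eqP/vnorm_eq0/eqP.
  rewrite eq_le vnorm_ge0 andbT; apply: H => s s01.
  by split; [exact: gb | exact: dg | rewrite subrr vnorm0].
move=> c c' e e0 c0 Hc.
have [h [h0 <- Hh]] : flows_to U X 1 x (flow U X 1 x) by apply: xgetPex;
  exists (g 1).
exact: compare Hc.
Qed.

End Picard.

(** * The interpolating flow *)

Section Assembly.
Local Open Scope complex_scope.
Variables (R : realType) (d : nat).
Implicit Types (F G : Cd R d -> Cd R d) (x y z : Cd R d) (D : set (Cd R d)).

Lemma supnorm_leP D G (c : R) :
  (supnorm D G <= c%:E)%E <-> forall x, D x -> vnorm (G x) <= c.
Proof.
split=> [H x Dx|H].
  by rewrite -lee_fin; apply: le_trans H; apply: ereal_sup_ubound; exists x.
by apply: ge_ereal_sup => _ [x Dx <-]; rewrite lee_fin; exact: H.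
Qed.

Lemma interp_curve_derivative F y m (s : R) : 0 <= s <= 1 ->
  unit_derivative (fun t => interp_curve F y m t%:C) s (interp_velocity F y m s%:C).
Proof.
move=> s01; pose K := \sum_(0 <= k < m.+1) k%:R * vnorm (newton_diff F k y).
have K0 : 0 <= K by apply: sumr_ge0 => k _; rewrite mulr_ge0 // vnorm_ge0.
move=> e e0; have K1 : 0 < K + 1 by rewrite ltr_wpDl.
exists (e / (K + 1)); first exact: divr_gt0.
move=> u u01; rewrite ltr_pdivlMr // => us.
apply: (@le_trans _ _ (K * (u - s) ^+ 2)); last first.
  rewrite -real_normK ?num_real // expr2 mulrA ler_wpM2r //.
  by apply: le_trans (ltW us); rewrite mulrC ler_wpM2l // lerDl.
rewrite /interp_curve /interp_velocity -sumrB scaler_sumr -sumrB.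
apply: le_trans (vnorm_sum _ _ _) _; rewrite /K mulr_suml;
  apply: ler_sum => k _.
rewrite scalerA -!scalerBl vnormZ !nbin_real dnbin_real -rmorphM -!rmorphB cabs_real mulrAC.
by rewrite ler_wpM2r ?vnorm_ge0 // nbin_taylor.
Qed.

Lemma midpoint_near x p q (b : R) : vnorm (p - x) <= b -> vnorm (q - x) <= b ->
  vnorm (2^-1 *: (p + q) - x) <= b.
Proof.
move=> px qx; have -> : 2^-1 *: (p + q) - x = 2^-1 *: ((p - x) + (q - x)).
  by rewrite -[X in _ - X = _](half_dbl x) -scalerBr opprD addrACA.
rewrite vnormZ cabsV cabs_nat; have := vnormD (p - x) (q - x); lra.
Qed.

Lemma dist_le_2 x p q (b : R) : vnorm (p - x) <= b -> vnorm (q - x) <= b ->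
  vnorm (p - q) <= 2 * b.
Proof. by move=> px; rewrite vnormC => qx; have := vnorm_triangle x p q;
  lra. Qed.

Lemma hol_lipschitz_ball G x (b B r rho : R) : 0 < r -> b <= r -> b + r < rho ->
  0 <= B ->
  (forall z, vnorm (z - x) < rho -> hol_at G z /\ vnorm (G z) <= B) ->
  forall p q, vnorm (p - x) <= b -> vnorm (q - x) <= b ->
    vnorm (G p - G q) <= B / r * vnorm (p - q).
Proof.
move=> r0 br brho B0 HG p q px qx; rewrite mulrAC -mulrA.
apply: hol_lipschitz => //.
  by apply: le_trans (dist_le_2 px qx) _; rewrite ler_wpM2l.
move=> z zc; apply: HG.
have := midpoint_near px qx; have := vnorm_triangle (2^-1 *: (p + q)) z x; lra.
Qed.

Lemma interp_field1 F z : interp_field F 1 z = F z - z.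
Proof. by rewrite /interp_field big_nat1 expr0 divr1 scale1r. Qed.

Section AtPoint.
Variables (F : Cd R d -> Cd R d) (x : Cd R d) (eps delta : R).
Hypotheses (eps0 : 0 < eps) (eps_delta : 15 * eps < delta).
Hypothesis holF : forall z, vnorm (z - x) < delta -> hol_at F z.
Hypothesis nearF : forall z, vnorm (z - x) < delta -> vnorm (F z - z) <= eps.

Let delta0 : 0 < delta. Proof. by move: eps0 eps_delta; lra. Qed.

(** The approximate solution is the segment from x to F x, whose defect is X_1(x) - X_1(c s). It is
    at most (3/2) eps^2 / delta, and Gronwall with L = 1/3 gives (9/5) eps^2 / delta. *)
Lemma flow_order1 (U : set (Cd R d)) : (forall z, vnorm (z - x) < delta ->
  U z) ->
  flow_dom U (interp_field F 1) 1 x /\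
  vnorm (flow U (interp_field F 1) 1 x - F x) <= 2 * eps ^+ 2 / delta.
Proof.
move=> HU; have e0 := ltW eps0.
have HX z : vnorm (z - x) < delta ->
    hol_at (interp_field F 1) z /\ vnorm (interp_field F 1 z) <= eps.
  move=> zx; rewrite interp_field1; split; last exact: nearF.
  rewrite (_ : interp_field F 1 = fun z => F z - z); last by apply/funext => w;
    rewrite interp_field1.
  by move=> w a waz wJ; apply: jet2vB => //; exact: (holF zx).
have lip (r : R) := @hol_lipschitz_ball (interp_field F 1) x eps eps r delta.
have HL p q : vnorm (p - x) <= eps -> vnorm (q - x) <= eps ->
    vnorm (interp_field F 1 p - interp_field F 1 q) <= 3^-1 * vnorm (p - q).
  move=> px qx; have := lip (3 * eps) _ _ _ e0 HX p q px qx.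
  rewrite (_ : eps / (3 * eps) = 3^-1); last by field; rewrite gt_eqF.
  apply; move: eps0 eps_delta; lra.
have [] := @flow_compare R d (interp_field F 1) U x eps delta 3^-1 e0 _ _ _ HL.
- by move: eps0 eps_delta; lra.
- by apply/andP; split; lra.
- by move=> z zx; split; [exact: HU | exact: (HX z zx).2].
move=> fd cmp; split => //.
pose c (s : R) : Cd R d := x + s%:C *: (F x - x).
have c1 : c 1 = F x by rewrite /c rmorph1 scale1r addrC subrK.
have x0 : vnorm (x - x) < delta by rewrite subrr vnorm0.
have Fx := nearF x0.
have cx s : 0 <= s <= 1 -> vnorm (c s - x) <= eps.
  move=> /andP[s0 s1]; rewrite /c addrC addKr vnormZ cabs_real ger0_norm //.
  by apply: le_trans Fx; rewrite ler_piMl ?vnorm_ge0.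
pose e := 3 / 2 * eps ^+ 2 / delta.
have ee0 : 0 <= e by rewrite !mulr_ge0 ?invr_ge0 // ltW.
have := cmp c (fun=> F x - x) e ee0; rewrite c1 => H.
apply: le_trans (H _ _) _.
- by rewrite /c rmorph0 scale0r addr0.
- move=> s s01; split; first exact: cx.
    move=> k k0; exists 1 => // u _ _.
    rewrite /c opprD addrACA subrr add0r -scalerBl -rmorphB subrr vnorm0.
    by rewrite mulr_ge0 // ltW.
  rewrite -(interp_field1 F x).
  have xx : vnorm (x - x) <= eps by rewrite subrr vnorm0.
  (* The radius 3 eps was enough for the Lipschitz constant 1/3; here a radius proportional to delta
     is taken, to obtain the quotient eps / delta. *)
  have dr : 0 < 2 / 3 * delta by rewrite mulr_gt0.
  have := lip (2 / 3 * delta) dr _ _ e0 HX x (c s) xx (cx s s01).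
  have e1 : eps <= 2 / 3 * delta by move: eps0 eps_delta; lra.
  have e2 : eps + 2 / 3 * delta < delta by move: eps0 eps_delta; lra.
  move=> /(_ e1 e2) Hl; apply: le_trans Hl _.
  have -> : e = eps / (2 / 3 * delta) * eps by rewrite /e; field;
    rewrite gt_eqF.
  by rewrite ler_wpM2l ?divr_ge0 ?(ltW dr) // vnormC; exact: cx.
- rewrite /e; set w := eps ^+ 2 / delta.
  have w0 : 0 <= w by rewrite divr_ge0 ?sqr_ge0 // ltW.
  have -> : 2 * eps ^+ 2 / delta = 2 * w by rewrite /w; field; rewrite gt_eqF.
  have -> : 3 / 2 * eps ^+ 2 / delta = 3 / 2 * w by rewrite /w; field;
    rewrite gt_eqF.
  have -> : 3 / 2 * w / (1 - 3^-1 / 2) = 9 / 5 * w by field.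
  by lra.
Qed.

Lemma flow_order_ge2 n (U : set (Cd R d)) : 6 * n.+1%:R * eps <= delta ->
  (forall z, vnorm (z - x) < delta / 3 -> U z) ->
  flow_dom U (interp_field F n.+2) 1 x /\
  vnorm (flow U (interp_field F n.+2) 1 x - F x) <=
    3 * eps * (6 * n.+1%:R * eps / delta) ^+ n.+2.
Proof.
move=> ne HU; have e0 := ltW eps0.
have [H1 H2 H3] := interp_bounds e0 holF nearF ne delta0.
pose b := 5 / 4 * eps; have b0 : 0 < b by rewrite mulr_gt0.
have n0 : 1 <= n.+1%:R :> R by rewrite ler1n.
have HX z : vnorm (z - x) < delta / 3 ->
    hol_at (interp_field F n.+2) z /\ vnorm (interp_field F n.+2 z) <= b.
  move=> zx; split; last exact: H1.
  move=> w a waz wJ; apply: fixed_field_jet2v => // j jn; rewrite waz;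
    apply: holF.
  have Hj : vnorm (z - x) + j%:R * eps < delta.
    have : j%:R * eps <= n.+1%:R * eps by rewrite ler_wpM2r // ler_nat.
    by move: delta0 ne; rewrite -mulrA; lra.
  by have [] := iter_near e0 nearF Hj.
(* Lipschitz constant 1/3 comes from Schwarz with radius 3 b; the room required is b + 3 b = 5 eps <
   delta / 3, which is the hypothesis 15 eps < delta. *)
have HL p q : vnorm (p - x) <= b -> vnorm (q - x) <= b ->
    vnorm (interp_field F n.+2 p - interp_field F n.+2 q)
      <= 3^-1 * vnorm (p - q).
  move=> px qx.
  have := @hol_lipschitz_ball (interp_field F n.+2) x b b (3 * b) (delta / 3) _
    _ _ (ltW b0) HX p q px qx.
  rewrite (_ : b / (3 * b) = 3^-1); last by field; rewrite gt_eqF.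
  by apply; rewrite /b; move: eps0 eps_delta; lra.
have [] := @flow_compare R d (interp_field F n.+2) U x b (delta / 3) 3^-1 (ltW b0) _ _ _ HL.
- by rewrite /b; move: eps0 eps_delta; lra.
- by apply/andP; split; lra.
- by move=> z zx; split; [exact: HU | exact: (HX z zx).2].
move=> fd cmp; split => //.
pose e := 5 / 2 * eps * (6 * n.+1%:R * eps / delta) ^+ n.+2.
have ee0 : 0 <= e.
  apply: mulr_ge0; first by rewrite mulr_ge0 ?divr_ge0.
  by rewrite exprn_ge0 // divr_ge0 ?(ltW delta0) // mulr_ge0.
have := cmp (fun s => interp_curve F x n.+2 s%:C) (fun s => interp_velocity F x n.+2 s%:C) e ee0.
rewrite rmorph0 rmorph1 interp_curve0 (@interp_curve_nat _ _ F x n.+2 1 isT) => H.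
apply: le_trans (H erefl _) _.
- move=> s s01; split; [exact: H2 | exact: interp_curve_derivative |].
  exact: defect_bound.
- rewrite /e; set w := (_ / delta) ^+ _; rewrite le_eqVlt; apply/orP; left;
  apply/eqP.
  by field.
Qed.

End AtPoint.

(** Exactly what 15 c_0 < 1 requires, since 15 / 6 = 5 / 2. *)
Lemma expR1_gt : 5 / 2 < expR 1 :> R.
Proof.
have -> : 1 = 6%:R * 6^-1 :> R by rewrite mulfV // pnatr_eq0.
rewrite expRM_natl; apply: (@lt_le_trans _ _ ((1 + 6^-1) ^+ 6)); first by lra.
by rewrite lerXn2r ?nnegrE ?expR_ge0 ?addr_ge0 ?invr_ge0 // expR_ge1Dx.
Qed.

End Assembly.

Theorem theorem3 (R : realType) (d : nat) (eps delta : R) (D0 : set (Cd R d)) :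
  let c0 : R := 1 / (6 * expR 1) in
  let M : nat := (`|Num.floor (c0 * delta / eps)|%N).+1 in
  let Ddelta := neighbourhood D0 delta in
  0 < eps -> 0 < delta -> eps / delta <= c0 ->
  forall F : Cd R d -> Cd R d,
  analytic_on Ddelta F ->
  (supnorm Ddelta (fun x => (F x - x)%R) <= eps%:E)%E ->
  let X := interp_field F in
  let U := interp_dom Ddelta F in
  [/\ (* (1) *)
      [/\ Ddelta `<=` U 1%N,
          (supnorm Ddelta (X 1%N) <= eps%:E)%E,
          D0 `<=` flow_dom (U 1%N) (X 1%N) 1 &
          (supnorm D0 (fun x => (flow (U 1%N) (X 1%N) 1 x - F x)%R)
             <= (2 * eps ^+ 2 / delta)%:E)%E],
      (* (2) *)
      forall m : nat, (2 <= m <= M)%N ->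
      [/\ neighbourhood D0 (delta / 3) `<=` U m,
          (supnorm (neighbourhood D0 (delta / 3)) (X m) <= (2 * eps)%:E)%E,
          D0 `<=` flow_dom (U m) (X m) 1 &
          (supnorm D0 (fun x => (flow (U m) (X m) 1 x - F x)%R)
             <= (3 * eps * (6 * (m.-1)%:R * eps / delta) ^+ m)%:E)%E] &
      (* (3) *)
      D0 `<=` flow_dom (U M) (X M) 1 /\
      (supnorm D0 (fun x => (flow (U M) (X M) 1 x - F x)%R)
         <= (3 * eps * expR (- (c0 * delta / eps)))%:E)%E].
Proof.
move=> c0 M Ddelta eps0 delta0 eps_c0 F anF /supnorm_leP supF X U.
have e1 := expR1_gt R; have ep : 0 < expR 1 :> R by exact: expR_gt0.
have c00 : 0 < c0 by rewrite divr_gt0 // mulr_gt0.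
have c0e : 6 * c0 = expR (- 1).
  by rewrite expRN /c0; field; rewrite gt_eqF.
have c15 : 15 * c0 < 1 by rewrite /c0 mulrA mulr1 ltr_pdivrMr ?mulr_gt0 // mul1r; lra.
have epsc : eps <= c0 * delta by move: eps_c0; rewrite ler_pdivrMr.
have eps15 : 15 * eps < delta.
  have : 15 * c0 * delta < 1 * delta by rewrite ltr_pM2r.
  by rewrite mul1r -mulrA; lra.
have inD x z : D0 x -> vnorm (z - x) < delta -> Ddelta z by move=> Dx zx;
  exists x.
have holF x : D0 x -> forall z, vnorm (z - x) < delta -> hol_at F z.
  by move=> Dx z /(inD _ _ Dx) Dz; apply: analytic_hol; exact: anF.
have nearF x : D0 x -> forall z, vnorm (z - x) < delta ->
  vnorm (F z - z) <= eps.
  by move=> Dx z /(inD _ _ Dx); exact: supF.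
have r0 : 0 <= c0 * delta / eps by rewrite divr_ge0 ?mulr_ge0 // ltW.
(* The absolute value in [M] is harmless, the floor being nonnegative. *)
have floorE : (M.-1%:R : R) = (Num.floor (c0 * delta / eps))%:~R.
  by rewrite /M /= natr_absz ger0_norm // floor_ge0.
have M1 : M.-1%:R <= c0 * delta / eps :> R by rewrite floorE floor_le.
have M2 : c0 * delta / eps <= M%:R.
  rewrite ltW // /M -natr1 -[X in X%:R + 1]/(M.-1) floorE.
  by have := floorD1_gt (c0 * delta / eps); rewrite intrD.
have Mge2 : (2 <= M)%N.
  rewrite ltnS lt0n absz_eq0 gt_eqF // floor_gt0 ler_pdivlMr // mul1r //.
(* For m = n + 2 <= M one has m - 1 <= c_0 delta / eps, and 6 c_0 = exp(-1). Part (2) uses only the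
   resulting bound by delta; part (3) uses the factor exp(-1). *)
have small_order n : (n.+2 <= M)%N -> 6 * n.+1%:R * eps <= expR (- 1) * delta.
  move=> nM; have : n.+1%:R <= c0 * delta / eps.
    by apply: le_trans M1; rewrite ler_nat -ltnS.
  by rewrite ler_pdivlMr // -c0e -!mulrA ler_pM2l.
have einv : expR (- 1) <= 1 :> R by rewrite -[leRHS]expR0 ler_expR; lra.
have part2 m : (2 <= m <= M)%N ->
      [/\ neighbourhood D0 (delta / 3) `<=` U m,
          (supnorm (neighbourhood D0 (delta / 3)) (X m) <= (2 * eps)%:E)%E,
          D0 `<=` flow_dom (U m) (X m) 1 &
          (supnorm D0 (fun x => (flow (U m) (X m) 1 x - F x)%R)
             <= (3 * eps * (6 * (m.-1)%:R * eps / delta) ^+ m)%:E)%E].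
  case: m => [|[|n]] // /andP[_ nM].
  have ne : 6 * n.+1%:R * eps <= delta.
    by apply: le_trans (small_order n nM) _; rewrite ler_piMl // ltW.
  have subU y z : D0 y -> vnorm (z - y) < delta / 3 -> U n.+2 z.
    move=> Dy zy j jn; exists y => //.
    have Hj : vnorm (z - y) + j%:R * eps < delta.
      have : j%:R * eps <= n.+1%:R * eps
        by rewrite ler_wpM2r ?(ltW eps0) // ler_nat.
      by move: ne; rewrite -mulrA; lra.
    by have [] := iter_near (ltW eps0) (nearF y Dy) Hj.
  have flows x : D0 x -> _ := fun Dx => flow_order_ge2 eps0 eps15 (holF x Dx)
    (nearF x Dx) ne (fun z => subU x z Dx).
  split.
  - by move=> z [y Dy zy]; exact: subU zy.
  - apply/supnorm_leP => z [y Dy zy].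
    have [H1 _ _] := interp_bounds (ltW eps0) (holF y Dy) (nearF y Dy) ne delta0.
    by apply: le_trans (H1 z zy) _; lra.
  - by move=> x /flows[].
  - by apply/supnorm_leP => x /flows[].
split => //.
- have subU : Ddelta `<=` U 1%N by move=> z Dz [].
  have flows x (Dx : D0 x) := flow_order1 eps0 eps15 (holF x Dx) (nearF x Dx)
    (fun z zx => subU z (inD x z Dx zx)).
  split => //.
  - by apply/supnorm_leP => z Dz; rewrite /X interp_field1; exact: supF.
  - by move=> x /flows[].
  - by apply/supnorm_leP => x /flows[].
- have [_ _ HD /supnorm_leP HB] := part2 M (introT andP (conj Mge2 (leqnn M))).
  split => //; apply/supnorm_leP => x Dx; apply: le_trans (HB x Dx) _.
  rewrite ler_wpM2l ?mulr_ge0 ?(ltW eps0) //.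
  (* The base is at most exp(-1), and M >= c_0 delta / eps gives exp(-M) <= exp(-c_0 delta /
     eps). *)
  apply: (@le_trans _ _ (expR (- 1) ^+ M)).
    rewrite lerXn2r ?nnegrE ?expR_ge0 // ?divr_ge0 ?mulr_ge0 ?(ltW eps0) ?(ltW delta0) //.
    rewrite ler_pdivrMr //; have := small_order M.-2.
    by case: (M) Mge2 => [|[|k]] // _; exact.
  by rewrite -expRM_natl ler_expR mulrN1 lerN2.
Qed.
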